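(* Let $G$ be a group and let $\mathcal{D}$ be a deformation space of $G$-trees. Then any two reduced $G$-trees in $\mathcal{D}$ are related by a finite sequence of slide moves, induction moves, and $\mathcal{A}^{\pm 1}$-moves, with all intermediate $G$-trees reduced.
   Context: Graphs. A graph has vertices $V$, oriented edges $E$, originating and terminal vertex maps $o,t\colon E\to V$, and a fixed-point-free involution $e\mapsto\bar e$ reversing orientation. A loop is an edge $e$ with $o(e)=t(e)$. A geometric edge is a pair $\{e,\bar e\}$. $G$-trees and marked graphs. A $G$-tree is a simplicial tree $T$ with an action of $G$ by simplicial automorphisms without inversions ($ge\ne\bar e$ for all $g\in G$, $e\in E(T)$). Two $G$-trees are identified if they are $G$-equivariantly isomorphic. By Bass--Serre theory $T$ corresponds to its quotient graph of groups $T/G$ together with an identification of $G$ with its fundamental group (a marked graph of groups, or marked graph). Notions for $G$-trees and marked graphs are used interchangeably; edge-to-vertex inclusions matter only up to conjugation in the vertex group (compatibly with the marking). Collapse and expansion. An edge $e$ of a $G$-tree is collapsible if $G_e=G_{o(e)}$ and its endpoints are not in the same $G$-orbit. Equivalently, an edge $e$ of a marked graph is collapsible if it is not a loop and the inclusion $G_e\hookrightarrow G_{o(e)}$ is surjective. Collapsing $\{e,\bar e\}$ (and all its translates, in the tree) to vertices is a collapse move. In the graph of groups, $o(e)$ and $t(e)$ are merged into a vertex with group $G_{t(e)}$, and edge groups that mapped to $G_{o(e)}$ now map to $G_{t(e)}$ via $G_{o(e)}\cong G_e\hookrightarrow G_{t(e)}$. The reverse of a collapse move is an expansion move. A $G$-tree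 (or marked graph) is reduced if it admits no collapse move. An elementary deformation is a finite sequence of collapse and expansion moves. The deformation space $\mathcal{D}$ of a $G$-tree $T$ is the set of all $G$-trees (equivalently marked graphs) related to $T$ by an elementary deformation. Ascending loops. Let a loop $e$ in a graph of groups have edge group $E$ and vertex group $A$, with inclusions $i_0,i_1\colon E\hookrightarrow A$. If one of these, say $i_0$, is an isomorphism, then $e$ is an ascending loop with monodromy $i_1\circ i_0^{-1}\colon A\hookrightarrow A$. Slide move. Let $e$ be an edge (possibly a loop) with edge group $C$, from a vertex $a$ with group $A$ to a vertex $b$ with group $B$. Let $S$ be a set, of any cardinality, of oriented edges originating at $a$, none equal to $e$ or $\bar e$, whose edge groups are contained in $C$ (all regarded as subgroups of $A$). The slide of $S$ over $e$ is an expansion followed by a collapse, as follows. First expand $a$: introduce a new vertex $w$ with group $C$ and a new edge with group $C$ joining $a$ to $w$ (inclusion $C\subseteq A$ at $a$, identity at $w$), and let $e$ and the edges of $S$ originate at $w$ instead of $a$, all other edge ends staying at $a$. Then collapse $e$, merging $w$ into $b$. The result has an edge with group $C$ from $a$ to $b$, as before, and each edge of $S$ with group $D$ now originates at $b$ via $D\subseteq C\hookrightarrow B$. When $e$ is a loop with inclusions $i_0,i_1\colon C\hookrightarrow A$, the effect is that the inclusion $j\colon D\hookrightarrow A$ of each sliding edge (with $j(D)\subseteq i_0(C)$) is replaced by $i_1\circ i_0^{-1}\circ j$. Sliding a whole collection of edges over one edge counts as a single slide move. Induction move. Let there be an ascending loop at a vertex $v$ with vertex group $A$ and monodromy $\phi\colon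 A\hookrightarrow A$, and let $B$ be a subgroup with $\phi(A)\subseteq B\subseteq A$. Expand $v$: introduce a new vertex $w$ with group $B$ and a new edge with group $B$ joining $w$ to $v$ (identity at $w$, inclusion $B\subseteq A$ at $v$). The loop becomes an edge with group $A$ joining $v$ to $w$ (identity at $v$, $\phi\colon A\hookrightarrow B$ at $w$), and all other edges stay at $v$. Then collapse this last edge. The result has an ascending loop with vertex group $B$ and monodromy $\phi|_B\colon B\hookrightarrow B$. This move and its reverse are both called induction moves. $\mathcal{A}^{\pm1}$-moves. Let there be an ascending loop at a vertex $v$ with vertex group $A$ and monodromy $\phi$. Suppose the only other edge incident to $v$ is a non-loop edge $f$ joining $v$ to a vertex $u\neq v$ with vertex group $C$, that $f$ has edge group $B$ with $\phi(A)\subseteq B\subseteq A$, and that $B$ is a proper subgroup of both $A$ and $C$. The $\mathcal{A}^{-1}$-move is as follows. Expand $v$ as in the induction move with subgroup $B$, with $f$ now attached to the new vertex $w$ (identity $B\to B$ at $w$). Collapse the edge with group $A$, obtaining a vertex with group $B$ carrying a loop with monodromy $\phi|_B$ and joined to $u$ by $f$. Then collapse $f$. The result is that $v$ and $f$ disappear and $u$, with group $C$, carries a new non-ascending loop with edge group $B$, whose inclusions into $C$ are $j$ and $j\circ\phi|_B$, where $j\colon B\hookrightarrow C$ is the inclusion of $f$ at $u$. The reverse of an $\mathcal{A}^{-1}$-move is called an $\mathcal{A}$-move. *)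

(* Defs.v *)
From Stdlib Require Import Relation_Operators.
From mathcomp Require Import all_boot.
From mathcomp Require Import boolp classical_sets.

Set Implicit Arguments.
Unset Strict Implicit.
Unset Printing Implicit Defensive.

Local Open Scope classical_set_scope.
Local Open Scope group_scope.

(* Graphs and trees in the sense of Serre. *)
Record graph : Type := Graph {
  vertex : Type;
  edge : Type;
  orig : edge -> vertex;
  term : edge -> vertex;
  rev : edge -> edge;
  revK : forall e, rev (rev e) = e;
  rev_neq : forall e, rev e <> e;
  orig_rev : forall e, orig (rev e) = term e
}.

(* [path_in S x p y]: p is an edge path from x to y with all edges in S. *)
Fixpoint path_in (X : graph) (S : set (edge X)) (x : vertex X)
    (p : seq (edge X)) (y : vertex X) : Prop :=
  if p is e :: p' then [/\ S e, orig e = x & path_in S (term e) p' y]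
  else x = y.

Fixpoint no_backtrack (X : graph) (p : seq (edge X)) : Prop :=
  if p is e :: p' then
    (if p' is e' :: _ then e' <> rev e else True) /\ no_backtrack p'
  else True.

Definition is_tree (X : graph) : Prop :=
  [/\ inhabited (vertex X),
      forall x y : vertex X, exists p, path_in setT x p y
    & forall (x : vertex X) p, path_in setT x p x -> no_backtrack p -> p = [::]].

Record gtree (G : groupType) : Type := GTree {
  gtree_graph :> graph;
  actV : G -> vertex gtree_graph -> vertex gtree_graph;
  actE : G -> edge gtree_graph -> edge gtree_graph;
  actV1 : forall v, actV 1 v = v;
  actVM : forall g h v, actV (g * h) v = actV g (actV h v);
  actE1 : forall e, actE 1 e = e;
  actEM : forall g h e, actE (g * h) e = actE g (actE h e);
  orig_act : forall g e, orig (actE g e) = actV g (orig e);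
  rev_act : forall g e, rev (actE g e) = actE g (rev e);
  no_inversion : forall g e, actE g e <> rev e;
  gtree_is_tree : is_tree gtree_graph
}.

Definition subgroup (G : groupType) (B : set G) : Prop :=
  B 1 /\ (forall x y, B x -> B y -> B (x * y^-1)).

Section GTrees.
Variable G : groupType.
Implicit Types T X Y : gtree G.

Definition gtree_iso T T' : Prop :=
  exists (fV : vertex T -> vertex T') (fE : edge T -> edge T'),
    [/\ bijective fV, bijective fE,
        forall g v, fV (actV g v) = actV g (fV v),
        forall g e, fE (actE g e) = actE g (fE e)
      & forall e, fV (orig e) = orig (fE e) /\ fE (rev e) = rev (fE e)].

Definition stabV T (v : vertex T) : set G := [set g | actV g v = v].
Definition stabE T (e : edge T) : set G := [set g | actE g e = e].
Definition orbitV T (v : vertex T) : set (vertex T) := [set actV g v | g in setT].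
Definition orbitE T (e : edge T) : set (edge T) := [set actE g e | g in setT].
Definition geom_orbit T (e : edge T) : set (edge T) :=
  orbitE e `|` orbitE (rev e).

Definition collapsible T (e : edge T) : Prop :=
  stabE e = stabV (orig e) /\ ~ orbitV (orig e) (term e).

Definition reduced T : Prop := forall e : edge T, ~ collapsible e.

(* T' is T with every translate of the geometric edge {d, rev d} shrunk to a
   vertex: q is the quotient map on vertices and i embeds the edges of T' as the
   edges of T that survive. This determines T' up to isomorphism. *)
Record is_collapse T T' (d : edge T)
    (q : vertex T -> vertex T') (i : edge T' -> edge T) : Prop := IsCollapse {
  collapse_collapsible : collapsible d;
  collapse_actV : forall g v, q (actV g v) = actV g (q v);
  collapse_actE : forall g e, i (actE g e) = actE g (i e);
  collapse_surj : forall v', exists v, q v = v';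
  collapse_fiber : forall v1 v2,
    q v1 = q v2 <-> exists p, path_in (geom_orbit d) v1 p v2;
  collapse_inj : injective i;
  collapse_range : forall e, (exists e', i e' = e) <-> ~ geom_orbit d e;
  collapse_rev : forall e', i (rev e') = rev (i e');
  collapse_orig : forall e', q (orig (i e')) = orig e'
}.

Definition collapse_move T T' : Prop :=
  exists (d : edge T) q i, @is_collapse T T' d q i.

(* Isomorphism steps are included because isomorphic G-trees are identified. *)
Definition elementary_deformation : gtree G -> gtree G -> Prop :=
  clos_refl_trans (gtree G) (fun T T' =>
    [\/ collapse_move T T', collapse_move T' T | gtree_iso T T']).

Definition deformation_space (D : gtree G -> Prop) : Prop :=
  exists T0, forall T, D T <-> elementary_deformation T0 T.

(* X is the expansion of T at v with new vertex w = orig d, whose group is K, and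
   new edge d, with group K, from w to v. Among the edges of T originating at v,
   those in M now originate at w, and those that are not translates of edges in M
   stay at v, which is [term d] in X. An edge y of T is the edge [i y] of X. The
   rest of X is determined by equivariance. *)
Record is_expansion_at T (v : vertex T) (K : set G) (M : set (edge T))
    X (d : edge X) (q : vertex X -> vertex T) (i : edge T -> edge X) : Prop :=
  IsExpansionAt {
  expansion_collapse : is_collapse d q i;
  expansion_vertex : q (orig d) = v;
  expansion_stabV : stabV (orig d) = K;
  expansion_stabE : stabE d = K;
  expansion_moved : forall y, M y -> orig (i y) = orig d;
  expansion_stay : forall y, orig y = v ->
    ~ (exists2 m, M m & orbitE m y) -> orig (i y) = term d
}.

(* The sliding edges are given by lifts s originating at the same vertex of the
   tree as the lift e, chosen so that [stabE s] is contained in [stabE e]. Two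
   lifts of one edge of the quotient graph in S must differ by an element of
   [stabE e], otherwise no X exists; so S is a set of edges of the quotient. *)
Definition slide T T' : Prop :=
  exists (e : edge T) (S : set (edge T)),
    (forall s, S s ->
       [/\ orig s = orig e, ~ geom_orbit e s & stabE s `<=` stabE e]) /\
    exists X (d : edge X) q i,
      is_expansion_at (orig e) (stabE e) (e |` S) d q i /\
      exists q' i', @is_collapse X T' (i e) q' i'.

(* e is a lift of an ascending loop; the element t identifies the vertex group at
   [term e] with A = stabV (orig e), so that the monodromy is g |-> t^-1 g t. *)
Definition ascending_loop T (e : edge T) (t : G) : Prop :=
  term e = actV t (orig e) /\ stabE e = stabV (orig e).

Definition monodromy (t g : G) : G := t^-1 * g * t.

(* The end of the loop that moves to the new vertex w is the terminal one: the
   lift of the reversed loop originating at [orig e] is [actE t^-1 (rev e)]. *)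
Definition induction_step T T' : Prop :=
  exists (e : edge T) (t : G) (B : set G),
    [/\ ascending_loop e t,
        subgroup B,
        monodromy t @` stabV (orig e) `<=` B
      & B `<=` stabV (orig e)] /\
    exists X (d : edge X) q i,
      is_expansion_at (orig e) B [set actE t^-1 (rev e)] d q i /\
      exists q' i', @is_collapse X T' (i e) q' i'.

Definition induction_move T T' : Prop :=
  induction_step T T' \/ induction_step T' T.

Definition A_inv_move T T' : Prop :=
  exists (e f : edge T) (t : G),
    [/\ ascending_loop e t,
        orig f = orig e,
        ~ orbitV (orig e) (term f)
      & forall x, orig x = orig e -> geom_orbit e x \/ orbitE f x] /\
    [/\ monodromy t @` stabV (orig e) `<=` stabE f,
        stabE f `<` stabV (orig e)
      & stabE f `<` stabV (term f)] /\
    exists X (d : edge X) q i,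
      is_expansion_at (orig e) (stabE f) [set actE t^-1 (rev e); f] d q i /\
      exists Y q' i', @is_collapse X Y (i e) q' i' /\
        exists (f' : edge Y) q'' i'',
          i' f' = i f /\ @is_collapse Y T' f' q'' i''.

Definition A_move T T' : Prop := A_inv_move T' T.

Inductive reduced_move T T' : Prop :=
| Move_iso of gtree_iso T T'
| Move_slide of slide T T'
| Move_induction of induction_move T T'
| Move_A of A_move T T'
| Move_A_inv of A_inv_move T T'.

(* Finite sequences of moves between reduced G-trees. *)
Definition related_by_moves : gtree G -> gtree G -> Prop :=
  clos_refl_trans (gtree G) (fun T T' =>
    [/\ reduced T, reduced T' & reduced_move T T']).

End GTrees.

(* Main.v *)
Require Import Defs.
From Stdlib Require Import Relation_Operators Operators_Properties.
From mathcomp Require Import all_boot.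
From mathcomp Require Import boolp classical_sets.
(* [rev] has to denote the reversal of edges rather than of sequences. *)
Import Defs.

Set Implicit Arguments.
Unset Strict Implicit.
Unset Printing Implicit Defensive.

Local Open Scope classical_set_scope.
Local Open Scope group_scope.

(** Why reduced trees of one deformation space are connected by moves.

    An elementary deformation is a chain of collapses and expansions. Every tree
    [X] on it can be collapsed step by step to some reduced tree, so it is enough
    to see that two reduced trees obtained in this way from one [X] are related
    by moves: then the reductions of consecutive trees of the chain are related,
    since an expansion read backwards is a collapse.

    Collapsing terminates although the quotient graph may be infinite. Call a
    vertex small if it is the origin of a collapsible edge. A reduced tree has no
    small vertex, an expansion creates at most two orbits of small vertices, and a
    collapse destroys at least one such orbit ([small_expand], [small_collapse]).
    The number of orbits of small vertices also serves as the measure for the main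
    induction.

    Suppose then that the claim holds for every collapse of [X], and let [a], [b]
    be collapsible edges of [X]. Write [a ~ b] ([similar]) if all reductions of
    [X/a] are related to all reductions of [X/b]; the point is that [a ~ b] always
    holds. If [b] is still collapsible in [X/a], then [X/a] and [X/b] have a common
    collapse and [a ~ b] by induction. Otherwise ([collapse_trichotomy]), up to
    translation, either [a] and [b] start at the same vertex, or they are parallel
    in the quotient with opposite origins.

    Same origin. Then [X/b] is obtained from [X/a] by a slide ([slide_of_two]), so
    nothing is left to do if both are reduced. If one is not, a third collapsible
    edge [c] intervenes; either it links [a] to [b] through pairs already treated,
    or there are collapsible edges [f], [b], [e] with [f] and [b] starting at one
    vertex [w], with [e] parallel and opposite to [b], and with [f] and [e]
    independent. In that configuration [X/b] carries [e] as an ascending loop at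
    the end of the edge [f]. Sliding everything else away from the loop, along [e]
    and then along [f], makes the A-inverse move applicable, and its result is
    exactly the collapse of [X] along [e] and [f] ([A_move_equi]).

    Opposite origins. If [X/a] and [X/b] are reduced, both have an ascending loop,
    and they differ by an induction move followed by one slide
    ([induction_move_equi]); otherwise a third edge reduces the question to the
    preceding cases.

    A slide is realised without changing the vertices and edges of the tree: only
    the origins of the sliding edges are altered ([slid]). Hence a slide in [X] and
    a collapse of [X] can be compared through one and the same quotient map, and
    all intermediate trees are quotients of slid copies of [X]. *)

(** * Paths and quotients of graphs *)
Section Graphs.
Implicit Types X Y : graph.

Lemma term_rev X (e : edge X) : term (rev e) = orig e.
Proof. by rewrite -orig_rev revK. Qed.

Definition conn X (S : set (edge X)) (x y : vertex X) : Prop :=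
  exists p, path_in S x p y.

Lemma conn_refl X (S : set (edge X)) x : conn S x x.
Proof. by exists [::]. Qed.

Lemma path_cat X (S : set (edge X)) x p y r z :
  path_in S x p y -> path_in S y r z -> path_in S x (p ++ r) z.
Proof.
elim: p x => [|e p IH] x /=; first by move=> ->.
by case=> Se ox hp hr; split=> //; apply: IH.
Qed.

Lemma conn_trans X (S : set (edge X)) x y z :
  conn S x y -> conn S y z -> conn S x z.
Proof. by move=> [p hp] [r hr]; exists (p ++ r); apply: path_cat hp hr. Qed.

Lemma conn_edge X (S : set (edge X)) e : S e -> conn S (orig e) (term e).
Proof. by move=> Se; exists [:: e]. Qed.

Lemma conn_elim X (S : set (edge X)) (P : vertex X -> Prop) x y :
  (forall e, S e -> P (orig e) -> P (term e)) -> conn S x y -> P x -> P y.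
Proof.
move=> hP [p]; elim: p x => [|e p IH] x /=; first by move=> ->.
by case=> Se <- hp Pe; apply: IH hp _; apply: hP.
Qed.

Lemma conn_sym X (S : set (edge X)) x y :
  (forall e, S e -> S (rev e)) -> conn S x y -> conn S y x.
Proof.
move=> hS c.
apply: (conn_elim (P := fun z => conn S z x)) c (conn_refl S x) => e Se.
by apply: conn_trans; have := conn_edge (hS _ Se); rewrite orig_rev term_rev.
Qed.

Lemma conn_sub X (S S' : set (edge X)) x y :
  S `<=` S' -> conn S x y -> conn S' x y.
Proof.
move=> hS c.
apply: (conn_elim (P := fun z => conn S' x z)) c (conn_refl S' x) => e Se c.
by apply: conn_trans c (conn_edge (hS _ Se)).
Qed.

Lemma reduce_path X (S : set (edge X)) x p y :
  path_in S x p y -> exists2 r, path_in S x r y & no_backtrack r.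
Proof.
elim: p x => [|e p IH] x /=; first by move=> h; exists [::].
case=> Se ox /IH[[|e' r] hr nb].
  by exists [:: e].
have [E|E] := pselect (e' = rev e); last by exists [:: e, e' & r].
case: hr => _ _; rewrite E term_rev ox => hr.
by exists r => //; case: nb.
Qed.

Lemma no_backtrack_cat X (S : set (edge X)) x r y e s :
  (forall f, S f -> S (rev f)) -> path_in S x r y -> no_backtrack r -> ~ S e ->
  no_backtrack (e :: s) -> no_backtrack (r ++ e :: s).
Proof.
move=> hS; elim: r x => [|f r IH] x //= [Sf _ hr] [h nb] nSe nbe.
split; last exact: IH hr nb nSe nbe.
case: r {IH nb} hr h => [|f' r] //= _ _ E.
by apply: nSe; rewrite E; apply: hS.
Qed.

(** [Y] is the quotient [X/F]. Vertices map forwards by [q] but edges backwards by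
    [i], because contracted edges have no image. Since the complement of [F] is the
    range of [i], the set [F] is automatically closed under reversal. *)
Record graph_quotient X Y (F : set (edge X))
    (q : vertex X -> vertex Y) (i : edge Y -> edge X) : Prop := GraphQuotient {
  gq_surj : forall v', exists v, q v = v';
  gq_fiber : forall v1 v2, q v1 = q v2 <-> conn F v1 v2;
  gq_inj : injective i;
  gq_range : forall e, (exists e', i e' = e) <-> ~ F e;
  gq_rev : forall e', i (rev e') = rev (i e');
  gq_orig : forall e', q (orig (i e')) = orig e'
}.

Section Quotient.
Variables (X Y : graph) (F : set (edge X)).
Variables (q : vertex X -> vertex Y) (i : edge Y -> edge X).
Hypothesis Q : graph_quotient F q i.

Lemma gq_out e : F e \/ exists e', e = i e'.
Proof.
have [Fe|nFe] := pselect (F e); first by left.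
by right; have [e' <-] := (gq_range Q e).2 nFe; exists e'.
Qed.

Lemma gq_notin e' : ~ F (i e').
Proof. by apply/(gq_range Q); exists e'. Qed.

Lemma gq_revF e : F e -> F (rev e).
Proof.
move=> Fe; have [//|[e' E]] := gq_out (rev e); exfalso.
have := gq_notin (e' := rev e'); apply.
by rewrite (gq_rev Q) -E revK.
Qed.

Lemma gq_term e' : q (term (i e')) = term e'.
Proof. by rewrite -!orig_rev -(gq_rev Q) (gq_orig Q). Qed.

Lemma gq_contract e : F e -> q (orig e) = q (term e).
Proof. by move=> Fe; apply/(gq_fiber Q); apply: conn_edge. Qed.

(** Connectivity in a quotient is connectivity upstairs by edges of [F] and lifts;
    this is what makes quotients compose and factor. *)
Lemma gq_conn (S : set (edge Y)) a b :
  conn S (q a) (q b) <-> conn (F `|` [set i e | e in S]) a b.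
Proof.
split=> [c|].
  suff: forall z, q z = q b -> conn (F `|` [set i e | e in S]) a z by apply.
  apply: (conn_elim (P := fun z' => forall z, q z = z' -> _)) c _.
    move=> e Se h z hz.
    have c1 := h _ (gq_orig Q e).
    apply: conn_trans c1 _; apply: (@conn_trans _ _ _ (term (i e))).
      by apply: conn_edge; right; exists e.
    apply: (@conn_sub _ F) => [f Ff|]; first by left.
    by apply/(gq_fiber Q); rewrite gq_term hz.
  move=> z /esym/(gq_fiber Q); apply: conn_sub => f Ff; by left.
move=> c; apply: (conn_elim (P := fun z => conn S (q a) (q z))) c (conn_refl _ _).
move=> e [Fe|[e' Se' <-]].
  by rewrite (gq_contract Fe).
rewrite (gq_orig Q) gq_term => c; exact: conn_trans c (conn_edge Se').
Qed.

(** A closed path without backtracking in the quotient lifts to one upstairs: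
    fill the gaps with reduced paths in the contracted subgraph. *)
Lemma quotient_tree : is_tree X -> is_tree Y.
Proof.
move=> [[x0] cX aX]; split; first by constructor; exact: (q x0).
  move=> x y; have [a <-] := gq_surj Q x; have [b <-] := gq_surj Q y.
  apply/gq_conn; apply: (@conn_sub _ setT); last exact: cX.
  move=> e _; have [Fe|[e' ->]] := gq_out e; first by left.
  by right; exists e'.
move=> x [//|e p] [_ oe hp] nb; exfalso.
suff [r hr nbr] : exists2 r, path_in setT (term (i e)) r (orig (i e)) &
    no_backtrack (i e :: r).
  by have := aX _ (i e :: r) (And3 Logic.I erefl hr) nbr.
have : q (orig (i e)) = x by rewrite (gq_orig Q).
move: (orig (i e)) => v qv {oe}.
have gap u z : q u = q z -> exists2 r, path_in F u r z & no_backtrack r.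
  by move/(gq_fiber Q) => [r]; apply: reduce_path.
(* Junctions do not backtrack: [F] is closed under reversal and avoids the lifts. *)
have full u r z : path_in F u r z -> path_in setT u r z.
  by elim: r u => [|f r IH] u //= [_ ? /IH].
have glue e1 r z : path_in F (term (i e1)) r z -> no_backtrack r ->
    forall s, no_backtrack (r ++ s) -> (r = [::] -> no_backtrack (i e1 :: s)) ->
    no_backtrack (i e1 :: (r ++ s)).
  case: r => [|f r] /= hr nbr s nbs h; first exact: h.
  split=> // E; case: hr => Ff _ _; apply: (@gq_notin (rev e1)).
  by rewrite (gq_rev Q) -E.
elim: p e hp nb => [|e2 p IH] e hp nb.
  have [r hr nbr] : exists2 r, path_in F (term (i e)) r v & no_backtrack r.
    by apply: gap; rewrite gq_term qv.
  exists r; first exact: full.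
  have := glue e _ _ hr nbr [::]; rewrite cats0; exact.
case: hp => _ o2 hp.
case: nb => ne nb2; have [s hs nbs] := IH e2 hp nb2.
have [r hr nbr] : exists2 r, path_in F (term (i e)) r (orig (i e2)) & no_backtrack r.
  by apply: gap; rewrite gq_term (gq_orig Q) o2.
exists (r ++ i e2 :: s).
  by apply: path_cat (full _ _ _ hr) _.
apply: (glue _ _ _ hr nbr).
  by apply: (no_backtrack_cat _ hr nbr (@gq_notin _) nbs); exact: gq_revF.
move=> _; split=> // E; apply: ne; apply: (gq_inj Q); by rewrite (gq_rev Q).
Qed.

(** A reduced closed path upstairs projects to a closed path in the tree [Y]. Where
    the latter backtracks, the former makes a reduced closed excursion inside [F],
    which is trivial when [F] is a forest. *)
Lemma quotient_tree_inv : is_tree Y ->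
  (forall x p, path_in F x p x -> no_backtrack p -> p = [::]) -> is_tree X.
Proof.
move=> [[y0] cY aY] aF; split.
- by have [x _] := gq_surj Q y0.
- move=> x y; have /gq_conn := cY (q x) (q y); exact: conn_sub.
move=> x p hp nb.
have nb_pref (r s : seq (edge X)) : no_backtrack (r ++ s) -> no_backtrack r.
  elim: r => [|f r IH] //= [h /IH nbr]; split=> //.
  by case: r h {IH nbr}.
(* [p'] is the projection of [p]; the last clause locates the lift of its first
   edge in [p], after an initial segment in [F]. *)
suff H : forall y, path_in setT x p y -> exists p', [/\ path_in setT (q x) p' (q y),
    no_backtrack p', (p' = [::] -> path_in F x p y) &
    forall e s, p' = e :: s -> exists f s', p = f ++ i e :: s' /\
      path_in F x f (orig (i e))].
  have [p' [hp' nb' h _]] := H x hp.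
  by have := aF x p (h (aY _ _ hp' nb')) nb.
elim: p x nb {hp} => [|e p IH] x nb y /=.
  by move=> ->; exists [::].
case=> _ ox hp.
have [p' [hp' nb' h0 h1]] := IH (term e) nb.2 y hp.
have [Fe|[e' E]] := gq_out e.
  exists p'; split=> //.
  - by rewrite -ox (gq_contract Fe).
  - by move=> /h0.
  - move=> e1 s /h1[f [s' [-> hf]]]; exists (e :: f), s'; split=> //.
exists (e' :: p'); split=> //.
- by split=> //; [rewrite -ox E (gq_orig Q)|rewrite -gq_term -E].
- split=> //; case: p' {hp' nb' h0} h1 => [|e1 s] // h1 E1.
  have [f [s' [Ep hf]]] := h1 _ _ erefl.
  have f0 : f = [::].
    apply: (aF (term e)).
      by move: hf; rewrite E1 (gq_rev Q) orig_rev -E.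
    by apply: (@nb_pref _ (i e1 :: s')); rewrite -Ep; case: nb.
  move: nb; rewrite /= Ep f0 /= E1 (gq_rev Q) -E; by case.
- move=> e1 s [<- _]; exists [::], p; rewrite E; split=> //=.
  by rewrite -E.
Qed.

End Quotient.
End Graphs.

(** * Orbits, stabilisers and equivariant quotients *)
Section Basics.
Variable G : groupType.
Implicit Types X Y Z T : gtree G.

Lemma conj_cancel (g k : G) : g^-1 * (g * k * g^-1) * g = k.
Proof. by rewrite !mulgA mulVg mul1g -mulgA mulVg mulg1. Qed.

Lemma actVK X g : cancel (@actV G X g) (actV g^-1).
Proof. by move=> v; rewrite -actVM mulVg actV1. Qed.
Lemma actVKV X g : cancel (@actV G X g^-1) (actV g).
Proof. by move=> v; rewrite -actVM mulgV actV1. Qed.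
Lemma actEK X g : cancel (@actE G X g) (actE g^-1).
Proof. by move=> v; rewrite -actEM mulVg actE1. Qed.
Lemma actEKV X g : cancel (@actE G X g^-1) (actE g).
Proof. by move=> v; rewrite -actEM mulgV actE1. Qed.

Lemma term_act X g (e : edge X) : term (actE g e) = actV g (term e).
Proof. by rewrite -!orig_rev rev_act orig_act. Qed.

Definition orbV X (v u : vertex X) : Prop := exists g, u = actV g v.

Lemma orbitVP X (v u : vertex X) : orbitV v u <-> orbV v u.
Proof. by split=> [[g _ <-]|[g ->]]; exists g. Qed.

Lemma orbV_refl X (v : vertex X) : orbV v v.
Proof. by exists 1; rewrite actV1. Qed.
Lemma orbV_sym X (v u : vertex X) : orbV v u -> orbV u v.
Proof. by case=> g ->; exists g^-1; rewrite actVK. Qed.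
Lemma orbV_trans X (v u w : vertex X) : orbV v u -> orbV u w -> orbV v w.
Proof. by case=> g -> [h ->]; exists (h * g); rewrite actVM. Qed.
Lemma orbV_act X (v : vertex X) g : orbV v (actV g v).
Proof. by exists g. Qed.

Lemma orbitEP X (d e : edge X) : orbitE d e <-> exists g, e = actE g d.
Proof. by split=> [[g _ <-]|[g ->]]; exists g. Qed.

Lemma geomP X (d e : edge X) :
  geom_orbit d e <-> exists g, e = actE g d \/ e = actE g (rev d).
Proof.
split=> [[] /orbitEP[g ->]|[g [] ->]]; [by exists g; left|by exists g; right| |].
- by left; apply/orbitEP; exists g.
- by right; apply/orbitEP; exists g.
Qed.

Lemma geom_refl X (d : edge X) : geom_orbit d d.
Proof. by apply/geomP; exists 1; rewrite actE1; left. Qed.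

Lemma geom_sym X (d e : edge X) : geom_orbit d e -> geom_orbit e d.
Proof.
move/geomP=> [g [] ->]; apply/geomP; exists g^-1; rewrite -?rev_act actEK.
  by left.
by right; rewrite revK.
Qed.

Lemma geom_rev X (d e : edge X) : geom_orbit d e -> geom_orbit d (rev e).
Proof.
move/geomP=> [g [] ->]; apply/geomP; exists g; rewrite rev_act; first by right.
by left; rewrite revK.
Qed.

Lemma geom_act X (d e : edge X) g : geom_orbit d e -> geom_orbit d (actE g e).
Proof.
by move/geomP=> [h [] ->]; apply/geomP; exists (g * h); rewrite !actEM; [left|right].
Qed.

Lemma geom_trans X (d e f : edge X) :
  geom_orbit d e -> geom_orbit e f -> geom_orbit d f.
Proof.
move=> de /geomP[g [] ->]; first exact: geom_act.
by apply: geom_act; apply: geom_rev.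
Qed.

Lemma geom_actE X (d e : edge X) g : geom_orbit d (actE g e) <-> geom_orbit d e.
Proof.
by split; [move/(geom_act g^-1); rewrite actEK|exact: geom_act].
Qed.

Lemma geom_revE X (d e : edge X) : geom_orbit d (rev e) <-> geom_orbit d e.
Proof. by split; [move/geom_rev; rewrite revK|exact: geom_rev]. Qed.

Lemma geom_eq X (d e : edge X) : geom_orbit d e -> geom_orbit e = geom_orbit d.
Proof.
move=> h; apply/seteqP; split=> f hf; apply: geom_trans hf => //; exact: geom_sym.
Qed.

Lemma geom_revl X (d : edge X) : geom_orbit (rev d) = geom_orbit d.
Proof. by apply: geom_eq; apply/geom_revE; exact: geom_refl. Qed.

Lemma stabE_rev X (e : edge X) : stabE (rev e) = stabE e.
Proof.
apply/seteqP; split=> g; rewrite /stabE /= -rev_act; last by move=> ->.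
by move/(congr1 (@rev X)); rewrite !revK.
Qed.

Lemma stabE_orig X (e : edge X) : stabE e `<=` stabV (orig e).
Proof. by move=> g; rewrite /stabE /stabV /= -orig_act => ->. Qed.

Lemma stabE_term X (e : edge X) : stabE e `<=` stabV (term e).
Proof. by move=> g; rewrite /stabE /stabV /= -term_act => ->. Qed.

Lemma stabV_act X (v : vertex X) g h : stabV (actV g v) h <-> stabV v (g^-1 * h * g).
Proof.
rewrite /stabV /= !actVM; split=> [->|]; first by rewrite actVK.
by move/(congr1 (actV g)); rewrite actVKV.
Qed.

Lemma stabE_act X (v : edge X) g h : stabE (actE g v) h <-> stabE v (g^-1 * h * g).
Proof.
rewrite /stabE /= !actEM; split=> [->|]; first by rewrite actEK.
by move/(congr1 (actE g)); rewrite actEKV.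
Qed.

Lemma subgroup_stabV X (v : vertex X) : subgroup (stabV v).
Proof.
split; rewrite /stabV /=; first by rewrite actV1.
by move=> x y hx hy; rewrite actVM -{1}hy actVK.
Qed.

Lemma collapsibleP X (d : edge X) :
  collapsible d <-> stabE d = stabV (orig d) /\ ~ orbV (orig d) (term d).
Proof. by split=> [] [h1 h2]; split=> // /orbitVP. Qed.

Lemma collapsible_act X (d : edge X) g : collapsible d -> collapsible (actE g d).
Proof.
move/collapsibleP=> [h1 h2]; apply/collapsibleP; split.
  apply/seteqP; split=> h; rewrite orig_act.
    by move/stabE_act; rewrite h1 => /stabV_act.
  by move/stabV_act; rewrite -h1 => /stabE_act.
rewrite orig_act term_act => h; apply: h2.
by apply: orbV_trans (orbV_trans h (orbV_sym (orbV_act _ g))); exact: orbV_act.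
Qed.

(** A collapse without the requirement that its edge be collapsible and with an
    arbitrary set of contracted edges, so that several collapses compose. *)
Record quotient X Y (F : set (edge X))
    (q : vertex X -> vertex Y) (i : edge Y -> edge X) : Prop := Quotient {
  quotient_graph :> graph_quotient F q i;
  quotient_actV : forall g v, q (actV g v) = actV g (q v);
  quotient_actE : forall g e, i (actE g e) = actE g (i e)
}.

Lemma collapse_quotient X Y (d : edge X) (q : vertex X -> vertex Y) i :
  is_collapse d q i <-> collapsible d /\ quotient (geom_orbit d) q i.
Proof.
split; first by case=> ? ? ? ? ? ? ? ? ?; split=> //; split=> //; split.
by case=> ? [] [] *; split.
Qed.

Section QuotientTheory.
Variables (X Y : gtree G) (F : set (edge X)).
Variables (q : vertex X -> vertex Y) (i : edge Y -> edge X).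
Hypothesis Q : quotient F q i.

Lemma quotient_stabE e : stabE (i e) = stabE e.
Proof.
apply/seteqP; split=> g; rewrite /stabE /= -(quotient_actE Q).
  by move/(gq_inj Q).
by move=> ->.
Qed.

Lemma quotient_stabV v : stabV v `<=` stabV (q v).
Proof. by move=> g; rewrite /stabV /= -(quotient_actV Q) => ->. Qed.

Lemma quotient_orbV u v : orbV u v -> orbV (q u) (q v).
Proof. by case=> g ->; exists g; rewrite (quotient_actV Q). Qed.

Lemma quotient_geom e f : geom_orbit (i e) (i f) <-> geom_orbit e f.
Proof.
split=> /geomP[g H]; apply/geomP; exists g; case: H => H.
- by left; apply: (gq_inj Q); rewrite (quotient_actE Q).
- by right; apply: (gq_inj Q); rewrite (quotient_actE Q) (gq_rev Q).
- by left; rewrite -(quotient_actE Q) -H.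
- by right; rewrite -(gq_rev Q) -(quotient_actE Q) -H.
Qed.

Lemma quotient_geom_image e :
  [set i f | f in geom_orbit e] = geom_orbit (i e).
Proof.
apply/seteqP; split=> f; first by case=> e' h <-; apply/quotient_geom.
move/geomP=> [g [] ->].
  by exists (actE g e); rewrite ?(quotient_actE Q) //; apply: geom_act; apply: geom_refl.
exists (actE g (rev e)); rewrite ?(quotient_actE Q) ?(gq_rev Q) //.
by apply: geom_act; apply/geom_revE; apply: geom_refl.
Qed.

(** Contracting edges can only enlarge vertex groups and create loops. *)
Lemma collapsible_lift e : collapsible e -> collapsible (i e).
Proof.
move/collapsibleP=> [h1 h2]; apply/collapsibleP; split.
  apply/seteqP; split; first exact: stabE_orig.
  by rewrite quotient_stabE h1 -(gq_orig Q); exact: quotient_stabV.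
by move/quotient_orbV; rewrite (gq_orig Q) (gq_term Q).
Qed.

End QuotientTheory.

Lemma quotient_comp X Y Z F F' (q : vertex X -> vertex Y) i (q' : vertex Y -> vertex Z) i' :
  quotient F q i -> quotient F' q' i' ->
  quotient (F `|` [set i f | f in F']) (q' \o q) (i \o i').
Proof.
move=> Q Q'; split=> [|g v|g e] /=; last 2 first.
- by rewrite (quotient_actV Q) (quotient_actV Q').
- by rewrite (quotient_actE Q') (quotient_actE Q).
split=> /=.
- by move=> z; have [y <-] := gq_surj Q' z; have [x <-] := gq_surj Q y; exists x.
- by move=> u v; rewrite (gq_fiber Q'); exact: (gq_conn Q).
- by apply: inj_comp; [exact: gq_inj Q|exact: gq_inj Q'].
- move=> e; split.
    case=> e' <- [/(gq_notin Q)//|[f Ff /(gq_inj Q) E]].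
    by apply: (gq_notin Q' (e' := e')); rewrite -E.
  move=> h; have [Fe|[e1 E1]] := gq_out Q e; first by case: h; left.
  have [Fe|[e2 E2]] := gq_out Q' e1; first by case: h; right; exists e1.
  by exists e2; rewrite -E2 -E1.
- by move=> e; rewrite (gq_rev Q') (gq_rev Q).
- by move=> e; rewrite (gq_orig Q) (gq_orig Q').
Qed.

Lemma quotient_factor X Y Z F F'' (q : vertex X -> vertex Y) i (r : vertex X -> vertex Z) j :
  quotient F q i -> quotient F'' r j -> F `<=` F'' ->
  exists q' i', [/\ quotient [set e | F'' (i e)] q' i', forall v, q' (q v) = r v &
    forall e, i (i' e) = j e].
Proof.
move=> Q R FF.
have hq y : exists v, q v = y by exact: gq_surj Q y.
have hi e : exists e', i e' = j e.
  by apply/(gq_range Q) => /FF; exact: (gq_notin R).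
pose q' y := r (projT1 (cid (hq y))).
pose i' e := projT1 (cid (hi e)).
have q'E v : q' (q v) = r v.
  rewrite /q'; case: cid => u /= /(gq_fiber Q) h; apply/(gq_fiber R).
  exact: conn_sub h.
have i'E e : i (i' e) = j e by rewrite /i'; case: cid.
exists q', i'; split=> //; split=> [|g y|g e].
- split.
  + by move=> z; have [v <-] := gq_surj R z; exists (q v).
  + move=> y1 y2; have [v1 <-] := hq y1; have [v2 <-] := hq y2.
    rewrite !q'E (gq_fiber R) (gq_conn Q).
    have -> // : F `|` [set i e | e in [set e | F'' (i e)]] = F''.
    apply/seteqP; split=> e; first by case=> [/FF|[e' h <-]].
    by have [Fe|[e' ->]] := gq_out Q e; [left|right; exists e'].
  + by move=> e f /(congr1 i); rewrite !i'E; exact: gq_inj R _ _.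
  + move=> e; split=> [[e' <-]|].
      by rewrite /= i'E; exact: (gq_notin R).
    by move/(gq_range R) => [e' h]; exists e'; apply: (gq_inj Q); rewrite i'E.
  + by move=> e; apply: (gq_inj Q); rewrite (gq_rev Q) !i'E (gq_rev R).
  + by move=> e; rewrite -(gq_orig Q) q'E i'E (gq_orig R).
- have [v <-] := hq y; by rewrite -(quotient_actV Q) !q'E (quotient_actV R).
- by apply: (gq_inj Q); rewrite (quotient_actE Q) !i'E (quotient_actE R).
Qed.

(** With this, isomorphisms are treated as collapses of no edge at all. *)
Lemma iso_quotient X Y :
  gtree_iso X Y <-> exists (q : vertex X -> vertex Y) i, quotient set0 q i.
Proof.
split.
  case=> fV [fE [bV [gE gK Kg] hV hE ho]]; have [gV VK KV] := bV.
  have grev e : gE (rev e) = rev (gE e).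
    by apply: (can_inj gK); rewrite (ho _).2 !Kg.
  exists fV, gE; split=> //.
    split=> //.
    - by move=> v; exists (gV v).
    - move=> u v; split=> [/(can_inj VK) ->|]; first exact: conn_refl.
      by case=> -[|e p] /=; [move=> ->|case=> []].
    - exact: can_inj Kg.
    - by move=> e; split=> [_ []|_] //; exists (fE e).
    - by move=> e; rewrite (ho _).1 Kg.
  by move=> g e; apply: (can_inj gK); rewrite hE !Kg.
case=> q [i Q].
have hq y : exists v, q v = y by exact: gq_surj Q y.
have hi e : exists e', i e' = e by apply/(gq_range Q).
have qinj : injective q.
  by move=> u v /(gq_fiber Q)[[|e p]] //= [].
pose fE e := projT1 (cid (hi e)).
have fEK e : i (fE e) = e by rewrite /fE; case: cid.
exists q, fE; split.
- exists (fun y => projT1 (cid (hq y))) => [x|y]; case: cid => //= u; exact: qinj.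
- by exists i => // e; apply: (gq_inj Q); rewrite fEK.
- exact: quotient_actV Q.
- by move=> g e; apply: (gq_inj Q); rewrite (quotient_actE Q) !fEK.
- move=> e; split; first by rewrite -(gq_orig Q) fEK.
  by apply: (gq_inj Q); rewrite (gq_rev Q) !fEK.
Qed.

Lemma quotient_unique X Y Y' F (q : vertex X -> vertex Y) i (q' : vertex X -> vertex Y') i' :
  quotient F q i -> quotient F q' i' -> gtree_iso Y Y'.
Proof.
move=> Q Q'; have [//|r [j [R _ _]]] := quotient_factor Q Q'.
apply/iso_quotient; exists r, j.
suff -> : set0 = [set e | F (i e)] by [].
by apply/seteqP; split=> // e /(gq_notin Q).
Qed.

Lemma iso_refl X : gtree_iso X X.
Proof. by exists id, id; split=> //; exists id. Qed.

Lemma iso_sym X Y : gtree_iso X Y -> gtree_iso Y X.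
Proof.
case=> fV [fE [[gV VK KV] [gE EK KE] hV hE ho]]; exists gV, gE; split.
- by exists fV.
- by exists fE.
- by move=> g v; apply: (can_inj VK); rewrite hV !KV.
- by move=> g v; apply: (can_inj EK); rewrite hE !KE.
- move=> e; split; first by apply: (can_inj VK); rewrite KV (ho _).1 KE.
  by apply: (can_inj EK); rewrite KE (ho _).2 KE.
Qed.

Lemma iso_trans X Y Z : gtree_iso X Y -> gtree_iso Y Z -> gtree_iso X Z.
Proof.
move=> /iso_quotient[q [i Q]] /iso_quotient[q' [i' Q']].
apply/iso_quotient; exists (q' \o q), (i \o i').
have := quotient_comp Q Q'.
by rewrite image_set0 setU0.
Qed.

(** ** Collapse of a single orbit *)
Section Collapse.
Variables (X Y : gtree G) (d : edge X).
Variables (q : vertex X -> vertex Y) (i : edge Y -> edge X).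
Hypotheses (cd : collapsible d) (Q : quotient (geom_orbit d) q i).

Lemma collapse_contract : q (orig d) = q (term d).
Proof. by apply: (gq_contract Q); exact: geom_refl. Qed.

(** The contracted forest is a disjoint union of stars centred at the translates
    of [term d], with leaves the translates of [orig d]. *)
Lemma collapse_eq u v : ~ orbV (orig d) v -> q u = q v ->
  u = v \/ exists g, u = actV g (orig d) /\ v = actV g (term d).
Proof.
move=> nv /esym /(gq_fiber Q) c; have [hs hl] := (collapsibleP d).1 cd.
pose P z := z = v \/ exists g, z = actV g (orig d) /\ v = actV g (term d).
apply: (conn_elim (P := P)) c (or_introl erefl) => e /geomP[g [] ->].
  rewrite orig_act term_act => -[E|[h [E1 E2]]].
    by case: nv; exists g.
  left; rewrite E2.
  have : stabE d (h^-1 * g).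
    by rewrite hs /stabV /= actVM E1 actVK.
  move/stabE_term; rewrite /stabV /= actVM => /(congr1 (actV h)).
  by rewrite actVKV.
rewrite orig_act orig_rev term_act term_rev => -[E|[h [E1 E2]]].
  by right; exists g.
case: hl; exists (g^-1 * h).
by rewrite actVM -E1 actVK.
Qed.

Lemma collapse_stabV v : ~ orbV (orig d) v -> stabV (q v) = stabV v.
Proof.
move=> nv; apply/seteqP; split; last exact: quotient_stabV Q _.
move=> g; rewrite /stabV /= -(quotient_actV Q) => /(collapse_eq nv)[//|[h [E _]]].
by case: nv; exists (g^-1 * h); rewrite actVM -E actVK.
Qed.

(** The only new coincidence between vertex orbits is that of the orbits of the two
    endpoints of [d]. *)
Lemma collapse_orbV u v : orbV (q u) (q v) ->
  [\/ orbV u v, orbV (orig d) u /\ orbV (term d) v,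
      orbV (term d) u /\ orbV (orig d) v
    | orbV (orig d) u /\ orbV (orig d) v].
Proof.
case=> g; rewrite -(quotient_actV Q) => E.
have [hu|nu] := pselect (orbV (orig d) u).
  have [hv|nv] := pselect (orbV (orig d) v); first by apply: Or44.
  have [E1|[h [E1 E2]]] := collapse_eq nv (esym E).
    by apply: Or41; exists g.
  by apply: Or42; split=> //; exists h.
have nu' : ~ orbV (orig d) (actV g u).
  by move=> h; apply: nu; apply: orbV_trans h (orbV_sym (orbV_act _ _)).
have [E1|[h [E1 E2]]] := collapse_eq nu' E.
  by apply: Or41; exists g.
apply: Or43; split; last by exists h.
by apply: orbV_trans (orbV_sym (orbV_act u g)); exists h.
Qed.

(** The group of the merged vertex contains that of [term d], and if the edge [i c],
    which starts at a leaf, fills it, then so does the group of [orig d]. *)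
Lemma collapsible_rev c : collapsible c -> orbV (orig d) (orig (i c)) ->
  collapsible (rev d).
Proof.
move=> cc [g Eg]; have [sd nld] := (collapsibleP d).1 cd.
apply/collapsibleP; rewrite orig_rev term_rev stabE_rev.
split; last by move/orbV_sym.
apply/seteqP; split; first exact: stabE_term.
move=> k; rewrite -(collapse_stabV nld) -collapse_contract sd => hk.
have [sc _] := (collapsibleP c).1 cc.
have : stabV (orig c) (g * k * g^-1).
  rewrite -(gq_orig Q) Eg (quotient_actV Q); apply/stabV_act.
  by rewrite conj_cancel.
rewrite -sc -(quotient_stabE Q) => /stabE_orig; rewrite Eg => /stabV_act.
by rewrite conj_cancel.
Qed.

End Collapse.
End Basics.

(** * Existence of collapses *)
Section CollapseExists.
Variables (G : groupType) (X : gtree G) (d : edge X).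
Hypothesis cd : collapsible d.

(** The quotient is modelled on the vertices outside the orbit of [orig d], that is,
    on the centres of the contracted stars. *)
Definition contract_vertex (v : vertex X) : vertex X :=
  if pselect (orbV (orig d) v) is left h then actV (projT1 (cid h)) (term d) else v.

(** Independence of [g] is the equality of the groups of [d] and [orig d]. *)
Lemma contract_vertex_orig g : contract_vertex (actV g (orig d)) = actV g (term d).
Proof.
rewrite /contract_vertex; case: pselect => [h|]; last by case; exists g.
case: cid => k /= E.
have /stabE_term : stabE d (k^-1 * g).
  by rewrite ((collapsibleP d).1 cd).1 /stabV /= actVM E actVK.
by rewrite /stabV /= actVM => /(congr1 (actV k)); rewrite actVKV.
Qed.

Lemma contract_vertex_id v : ~ orbV (orig d) v -> contract_vertex v = v.
Proof. by rewrite /contract_vertex; case: pselect. Qed.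

Lemma contract_vertexP v : ~ orbV (orig d) (contract_vertex v).
Proof.
have [[g ->]|nv] := pselect (orbV (orig d) v); last by rewrite contract_vertex_id.
rewrite contract_vertex_orig => h; apply: ((collapsibleP d).1 cd).2.
exact: orbV_trans h (orbV_sym (orbV_act _ g)).
Qed.

Lemma contract_vertex_act g v : contract_vertex (actV g v) = actV g (contract_vertex v).
Proof.
have [[h ->]|nv] := pselect (orbV (orig d) v).
  by rewrite -actVM !contract_vertex_orig actVM.
rewrite !contract_vertex_id // => h; apply: nv.
exact: orbV_trans h (orbV_sym (orbV_act _ g)).
Qed.

Let PV (v : vertex X) := ~ orbV (orig d) v.
Let PE (e : edge X) := ~ geom_orbit d e.
Let V := {v : vertex X | PV v}.
Let E := {e : edge X | PE e}.

Let V_eq (u v : V) : sval u = sval v -> u = v.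
Proof. by case: u v => [u hu] [v hv]; exact: eq_exist. Qed.
Let E_eq (u v : E) : sval u = sval v -> u = v.
Proof. by case: u v => [u hu] [v hv]; exact: eq_exist. Qed.

Let proj (v : vertex X) : V := exist PV _ (contract_vertexP (v := v)).

Let rev_notin (e : E) : ~ geom_orbit d (rev (sval e)).
Proof. by move/geom_revE; exact: (svalP e). Qed.
Let act_notin g (e : E) : ~ geom_orbit d (actE g (sval e)).
Proof. by move/geom_actE; exact: (svalP e). Qed.
Let actV_notin g (v : V) : ~ orbV (orig d) (actV g (sval v)).
Proof.
by move=> h; apply: (svalP v); exact: orbV_trans h (orbV_sym (orbV_act _ g)).
Qed.

Let contract_graph : graph.
refine (@Graph V E (fun e => proj (orig (sval e))) (fun e => proj (term (sval e)))
  (fun e => exist PE _ (rev_notin (e := e))) _ _ _).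
- by move=> e; apply: E_eq; rewrite /= revK.
- by move=> e /(congr1 (@sval _ _)) /=; exact: rev_neq.
- by move=> e /=; rewrite orig_rev.
Defined.

Let contract_quotient : graph_quotient (Y := contract_graph) (geom_orbit d) proj (@sval _ _ : edge contract_graph -> edge X).
Proof.
split=> //.
- move=> v; exists (sval v); apply: V_eq => /=.
  by apply: contract_vertex_id; exact: (svalP v).
- move=> u v; split; last first.
    move=> c; apply: (conn_elim (P := fun z => proj u = proj z)) c erefl.
    move=> e /geomP[g H] ->; apply: V_eq => /=.
    case: H => ->; rewrite orig_act term_act ?orig_rev ?term_rev !contract_vertex_act;
      rewrite -[orig d]actV1 contract_vertex_orig actV1 contract_vertex_id //;
      exact: ((collapsibleP d).1 cd).2.
  move/(congr1 (@sval _ _)) => /= Ec.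
  have to_center z : conn (geom_orbit d) z (contract_vertex z).
    have [[g ->]|nv] := pselect (orbV (orig d) z); last first.
      by rewrite contract_vertex_id //; exact: conn_refl.
    rewrite contract_vertex_orig -orig_act -term_act; apply: conn_edge.
    by apply: geom_act; exact: geom_refl.
  apply: conn_trans (to_center u) _; rewrite Ec; apply: conn_sym (to_center v).
  by move=> e; exact: geom_rev.
- move=> e; split=> [[e' <-]|h]; first exact: (svalP e').
  by exists (exist PE e h).
Qed.

Lemma collapse_exists : exists (Y : gtree G) (q : vertex X -> vertex Y) i, is_collapse d q i.
Proof.
pose aV g (v : vertex contract_graph) : vertex contract_graph := exist PV _ (actV_notin (g := g) (v := v)).
pose aE g (e : edge contract_graph) : edge contract_graph := exist PE _ (act_notin (g := g) (e := e)).
unshelve eexists (@GTree G contract_graph aV aE _ _ _ _ _ _ _ (quotient_tree contract_quotient (gtree_is_tree X))).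
- by move=> v; apply: V_eq; rewrite /= actV1.
- by move=> g h v; apply: V_eq; rewrite /= actVM.
- by move=> v; apply: E_eq; rewrite /= actE1.
- by move=> g h v; apply: E_eq; rewrite /= actEM.
- by move=> g e; apply: V_eq; rewrite /= orig_act contract_vertex_act.
- by move=> g e; apply: E_eq; rewrite /= rev_act.
- by move=> g e /(congr1 (@sval _ _)); exact: no_inversion.
exists proj, (@sval _ _); apply/collapse_quotient; split=> //.
split=> [|g v|g e] //; apply: V_eq => /=; exact: contract_vertex_act.
Qed.

End CollapseExists.

(** * Slides as regluings *)
Section Slide.
Variables (G : groupType) (X : gtree G) (e : edge X) (S : set (edge X)).

(** [S] is a set of lifts of sliding edges, all starting where [e] does. The last
    condition says that two lifts of one edge differ by an element of the group of
    [e]; with [g] fixing [s] it contains the inclusion of the group of [s]. *)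
Record slidable : Prop := Slidable {
  slidable_orig : forall s, S s -> orig s = orig e;
  slidable_notin : forall s, S s -> ~ geom_orbit e s;
  slidable_stab : forall s g, S s -> S (actE g s) -> stabE e g
}.

Definition spread : set (edge X) := [set y | exists g s, S s /\ y = actE g s].

(** Origins after the slide. The group element [g] with [y = actE g s] is chosen,
    but [slid_orig_in] shows that the value does not depend on the choice. *)
Definition slid_orig (y : edge X) : vertex X :=
  if pselect (exists p : G * edge X, S p.2 /\ y = actE p.1 p.2) is left h
  then actV (projT1 (cid h)).1 (term e) else orig y.

Lemma slid_orig_out y : ~ spread y -> slid_orig y = orig y.
Proof.
by rewrite /slid_orig; case: pselect => // h []; case: h => -[g s] [Ss E]; exists g, s.
Qed.

Lemma spread_act g y : spread (actE g y) <-> spread y.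
Proof.
split=> -[h [s [Ss E]]].
  by exists (g^-1 * h), s; split=> //; rewrite actEM -E actEK.
by exists (g * h), s; rewrite E actEM.
Qed.

Hypothesis sl : slidable.

Lemma spread_notin y : spread y -> ~ geom_orbit e y.
Proof. by case=> g [s [Ss ->]] /geom_actE; exact: slidable_notin. Qed.

Lemma slid_orig_in g s : S s -> slid_orig (actE g s) = actV g (term e).
Proof.
move=> Ss; rewrite /slid_orig; case: pselect => [h|]; last by case; exists (g, s).
case: cid => -[k s'] /= [Ss' E].
have Es' : s' = actE (k^-1 * g) s by rewrite actEM E actEK.
rewrite Es' in Ss'; have /stabE_term := slidable_stab sl Ss Ss'.
by rewrite /stabV /= actVM => /(congr1 (actV k)); rewrite actVKV.
Qed.

Lemma slid_orig_act g y : slid_orig (actE g y) = actV g (slid_orig y).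
Proof.
have [[h [s [Ss ->]]]|n] := pselect (spread y).
  by rewrite -actEM !slid_orig_in // actVM.
by rewrite !slid_orig_out ?orig_act // => /spread_act.
Qed.

(** The tree halfway through a slide, after the expansion: each translate [y] of [e]
    gets a new vertex [inr y], joined to [orig y] by a new edge [inr (y, true)], and
    [y] and its sliding edges now start at [inr y]. The group of the new vertex is
    that of [e] because its orbit is modelled on the orbit of [e]. *)
Definition on_orbit (y : edge X) : Prop := exists g, y = actE g e.
Definition half_vertex : Type := (vertex X + {y | on_orbit y})%type.
Definition half_edge : Type := (edge X + {y | on_orbit y} * bool)%type.

Definition new_vertex g : {y | on_orbit y} :=
  exist on_orbit (actE g e) (ex_intro _ g erefl).

Lemma orbit_eq (u v : {y | on_orbit y}) : sval u = sval v -> u = v.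
Proof. by case: u v => [u hu] [v hv]; exact: eq_exist. Qed.

Lemma new_vertexP (u : {y | on_orbit y}) : exists g, u = new_vertex g.
Proof. by case: u => y [g E]; exists g; apply: orbit_eq. Qed.

Definition moving (m : edge X) : Prop := m = e \/ S m.

Definition half_orig (y : half_edge) : half_vertex :=
  match y with
  | inl y =>
    if pselect (exists p : G * edge X, moving p.2 /\ y = actE p.1 p.2) is left h
    then inr (new_vertex (projT1 (cid h)).1) else inl (orig y)
  | inr (y, true) => inr y
  | inr (y, false) => inl (orig (sval y))
  end.

Definition half_rev (y : half_edge) : half_edge :=
  match y with inl y => inl (rev y) | inr (y, b) => inr (y, ~~ b) end.

Lemma half_revK y : half_rev (half_rev y) = y.
Proof. by case: y => [y|[y b]] /=; rewrite ?revK ?negbK. Qed.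

Lemma half_rev_neq y : half_rev y <> y.
Proof.
by case: y => [y|[y []]] //= E; have := @rev_neq X y; apply; case: E.
Qed.

Definition half_graph : graph :=
  @Graph half_vertex half_edge half_orig (fun y => half_orig (half_rev y)) half_rev
    half_revK half_rev_neq (fun _ => erefl).

(** There are no inversions. *)
Lemma not_rev_orbit g h : rev (actE g e) <> actE h e.
Proof.
rewrite rev_act => /(congr1 (actE g^-1)); rewrite actEK -actEM => /esym.
exact: no_inversion.
Qed.

Lemma moving_stab m m' g h : moving m -> moving m' -> actE g m = actE h m' ->
  actE g e = actE h e.
Proof.
move=> [->|Sm] [->|Sm'] // E.
- case: (slidable_notin sl Sm'); apply/geomP; exists (h^-1 * g); left.
  by rewrite actEM E actEK.
- case: (slidable_notin sl Sm); apply/geomP; exists (g^-1 * h); left.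
  by rewrite actEM -E actEK.
have Em : m' = actE (h^-1 * g) m by rewrite actEM E actEK.
rewrite Em in Sm'; have := slidable_stab sl Sm Sm'.
by rewrite /stabE /= actEM => /(congr1 (actE h)); rewrite actEKV.
Qed.

Lemma half_orig_in g m : moving m -> half_orig (inl (actE g m)) = inr (new_vertex g).
Proof.
move=> Mm /=; case: pselect => [h|]; last by case; exists (g, m).
case: cid => -[k m'] /= [Mm' E]; congr inr; apply: orbit_eq => /=.
by apply: moving_stab Mm' Mm _.
Qed.

Lemma half_orig_e g : half_orig (inl (actE g e)) = inr (new_vertex g).
Proof. by apply: half_orig_in; left. Qed.

Lemma half_orig_out y : ~ on_orbit y -> ~ spread y -> half_orig (inl y) = inl (orig y).
Proof.
move=> no ns /=; case: pselect => // h; exfalso; case: h => -[g m] /= [[->|Sm] E].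
  by apply: no; exists g.
by apply: ns; exists g, m.
Qed.

Variant moving_spec (y : edge X) : half_vertex -> Prop :=
  | MovingE g of y = actE g e : moving_spec y (inr (new_vertex g))
  | MovingS g s of S s & y = actE g s : moving_spec y (inr (new_vertex g))
  | MovingN of ~ on_orbit y & ~ spread y : moving_spec y (inl (orig y)).

Lemma movingP y : moving_spec y (half_orig (inl y)).
Proof.
have [[g E]|no] := pselect (on_orbit y).
  by rewrite {2}E half_orig_e; constructor.
have [[g [s [Ss E]]]|ns] := pselect (spread y).
  rewrite {2}E half_orig_in; last by right.
  exact: MovingS E.
by rewrite half_orig_out //; constructor.
Qed.

Lemma term_e_out g : half_orig (inl (rev (actE g e))) = inl (actV g (term e)).
Proof.
rewrite half_orig_out ?orig_rev ?term_act //; first by case=> h /not_rev_orbit.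
by move/spread_notin; apply; apply: geom_rev; apply: geom_act; exact: geom_refl.
Qed.

Definition fold_back (v : half_vertex) : vertex X :=
  match v with inl v => v | inr y => orig (sval y) end.

Definition new_edges : set (edge half_graph) :=
  [set y | match y with inl _ => False | inr _ => True end].

(** Contracting the new edges gives back the original tree; together with
    [quotient_tree_inv] this shows that the half-slid graph is a tree. *)
Lemma fold_back_quotient :
  graph_quotient (X := half_graph) (Y := X) new_edges fold_back inl.
Proof.
split=> //.
- by move=> v; exists (inl v).
- have to_base (z : vertex half_graph) : conn new_edges z (inl (fold_back z)).
    case: z => [v|y] /=; first exact: conn_refl.
    have -> : inr y = @orig half_graph (inr (y, true)) by [].
    have -> : inl (orig (sval y)) = @term half_graph (inr (y, true)) by [].
    exact: conn_edge.
  move=> u v; split=> [E|c].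
    apply: conn_trans (to_base u) _; rewrite E; apply: conn_sym (to_base v).
    by case=> // -[].
  apply: (@conn_elim half_graph new_edges (fun z => fold_back u = fold_back z) u v) c erefl.
  by move=> [//|[y []]] _ ->.
- by move=> y z [].
- move=> [y|y]; split; [by move=> _ []|by exists y|by case|by case].
- move=> y; change (fold_back (half_orig (inl y)) = orig y).
  case: (movingP y) => [g E|g s Ss E|no ns] //=.
    by rewrite E.
  by rewrite E !orig_act (slidable_orig sl Ss).
Qed.

(** The contracted edges form stars whose leaves are the new vertices, and a
    reduced path in a star has length at most two. *)
Lemma half_tree : is_tree half_graph.
Proof.
apply: (quotient_tree_inv fold_back_quotient); first exact: gtree_is_tree.
move=> x [//|[y|[y b]] p] [Fa <-]; first by case: Fa.
case: b {Fa}; case: p => [|[y2|[y2 b2]] p] //=.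
- by move=> [[]].
- case: b2 => [] [_ E2 hp] [ne] // {E2}.
  case: p hp => [[E]|[y3|[y3 b3]] p] /=; first by case: ne; rewrite E.
    by case=> [[]].
  by case: b3 => [] [_ E _] [ne'] //; case: ne'; case: E => ->.
- by move=> [[]].
- by case: b2 => [] [_ E _] [ne'] //; case: ne'; case: E => ->.
Qed.

Lemma on_orbit_act g y : on_orbit y -> on_orbit (actE g y).
Proof. by case=> h ->; exists (g * h); rewrite actEM. Qed.

Definition half_actV g (v : half_vertex) : half_vertex :=
  match v with
  | inl v => inl (actV g v)
  | inr y => inr (exist on_orbit (actE g (sval y))
      (on_orbit_act g (svalP y)))
  end.

Definition half_actE g (y : half_edge) : half_edge :=
  match y with
  | inl y => inl (actE g y)
  | inr (y, b) => inr (exist on_orbit (actE g (sval y))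
      (on_orbit_act g (svalP y)), b)
  end.

Lemma half_actV_new g h :
  half_actV g (inr (new_vertex h)) = inr (new_vertex (g * h)).
Proof. by congr inr; apply: orbit_eq; rewrite /= actEM. Qed.

Lemma half_actE_new g h b :
  half_actE g (inr (new_vertex h, b)) = inr (new_vertex (g * h), b).
Proof. by congr (inr (_, b)); apply: orbit_eq; rewrite /= actEM. Qed.

Lemma half_orig_act g y : half_orig (half_actE g y) = half_actV g (half_orig y).
Proof.
case: y => [y|[y b]]; last first.
  have [h ->] := new_vertexP y; rewrite half_actE_new.
  case: b; first by rewrite half_actV_new.
  by rewrite /= actEM -orig_act.
change (half_actE g (inl y)) with (inl (actE g y) : half_edge).
case: (movingP y) => [h ->|h s Ss ->|no ns].
- by rewrite half_actV_new -actEM half_orig_e.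
- by rewrite half_actV_new -actEM half_orig_in //; right.
rewrite half_orig_out ?orig_act //.
  by case=> h E; apply: no; exists (g^-1 * h); rewrite actEM -E actEK.
by move/spread_act.
Qed.

Definition half : gtree G.
refine (@GTree G half_graph half_actV half_actE _ _ _ _ half_orig_act _ _ half_tree).
- by case=> [v|y] /=; rewrite ?actV1 //; congr inr; apply: orbit_eq; rewrite /= actE1.
- by move=> g h [v|y] /=; rewrite ?actVM //; congr inr; apply: orbit_eq; rewrite /= actEM.
- by case=> [v|[y b]] /=; rewrite ?actE1 //; congr (inr (_, b)); apply: orbit_eq; rewrite /= actE1.
- by move=> g h [v|[y b]] /=; rewrite ?actEM //; congr (inr (_, b)); apply: orbit_eq; rewrite /= actEM.
- by move=> g [y|[y b]] //=; rewrite rev_act.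
- by move=> g [y|[y []]] //= []; exact: no_inversion.
Defined.

Definition new_edge : edge half := inr (new_vertex 1, true).

Lemma geom_new_edge : geom_orbit new_edge = new_edges.
Proof.
apply/seteqP; split=> y; first by case/geomP=> g [] ->.
case: y => [//|[y b]] _; have [g ->] := new_vertexP y; apply/geomP; exists g.
have -> : inr (new_vertex g, b) = @actE G half g (inr (new_vertex 1, b)).
  by rewrite [RHS]half_actE_new mulg1.
by case: b; [left|right].
Qed.

Lemma half_stab_vertex : @stabV G half (inr (new_vertex 1)) = stabE e.
Proof.
apply/seteqP; split=> g; rewrite /stabV /stabE /=.
  by case; rewrite actE1.
by move=> E; congr inr; apply: orbit_eq; rewrite /= actE1.
Qed.

Lemma half_stab_new_edge : stabE new_edge = stabE e.
Proof.
apply/seteqP; split=> g; rewrite /stabE /=.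
  by case; rewrite actE1.
by move=> E; congr (inr (_, true)); apply: orbit_eq; rewrite /= actE1.
Qed.

Lemma half_collapse :
  @is_collapse G half X new_edge fold_back inl.
Proof.
apply/collapse_quotient; split.
  apply/collapsibleP; split; first by rewrite half_stab_new_edge -half_stab_vertex.
  by case=> g.
rewrite geom_new_edge; split=> //; first exact: fold_back_quotient.
by move=> g [v|y] //=; rewrite orig_act.
Qed.

Definition slid_graph : graph :=
  @Graph (vertex X) (edge X) slid_orig (fun y => slid_orig (rev y)) (@rev X)
    (@revK X) (@rev_neq X) (fun _ => erefl).

Definition fold_fwd (v : half_vertex) : vertex X :=
  match v with inl v => v | inr y => term (sval y) end.

(** Collapsing [e] in the half-slid tree removes [e] itself; its role is then played
    by the new edge, traversed from [orig e] to the new vertex. *)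
Definition slid_edge (y : edge X) : half_edge :=
  if pselect (on_orbit y) is left h then inr (exist on_orbit y h, false)
  else if pselect (on_orbit (rev y)) is left h
  then inr (exist on_orbit (rev y) h, true) else inl y.

Lemma slid_edge_e g : slid_edge (actE g e) = inr (new_vertex g, false).
Proof.
rewrite /slid_edge; case: pselect => [h|]; last by case; exists g.
by congr (inr (_, false)); apply: orbit_eq.
Qed.

Lemma slid_edge_rev_e g : slid_edge (rev (actE g e)) = inr (new_vertex g, true).
Proof.
rewrite /slid_edge; case: pselect => [[h /not_rev_orbit]|_] //.
case: pselect => [h|]; last by case; exists g; rewrite revK.
by congr (inr (_, true)); apply: orbit_eq; rewrite /= revK.
Qed.

Lemma slid_edge_out y : ~ geom_orbit e y -> slid_edge y = inl y.
Proof.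
move=> n; rewrite /slid_edge; case: pselect => [[h E]|_].
  by case: n; apply/geomP; exists h; left.
case: pselect => [[h E]|_] //.
by case: n; apply/geom_revE; apply/geomP; exists h; left.
Qed.

Definition old_edges : set (edge half_graph) :=
  [set y | match y with inl y => geom_orbit e y | inr _ => False end].

Variant geom_spec (y : edge X) : half_edge -> Prop :=
  | GeomE g of y = actE g e : geom_spec y (inr (new_vertex g, false))
  | GeomR g of y = rev (actE g e) : geom_spec y (inr (new_vertex g, true))
  | GeomN of ~ geom_orbit e y : geom_spec y (inl y).

Lemma slid_edgeP y : geom_spec y (slid_edge y).
Proof.
have [/geomP[g [] E]|n] := pselect (geom_orbit e y).
- by rewrite {2}E slid_edge_e; constructor.
- by rewrite {2}E -rev_act slid_edge_rev_e; constructor; rewrite E rev_act.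
- by rewrite slid_edge_out //; constructor.
Qed.

(** Contracting the translates of [e] completes the slide, so the regluing of [X] is
    a quotient of a tree, hence a tree. *)
Lemma fold_fwd_quotient :
  graph_quotient (X := half_graph) (Y := slid_graph) old_edges fold_fwd slid_edge.
Proof.
split.
- by move=> v; exists (inl v).
- have to_base (z : vertex half_graph) : conn old_edges z (inl (fold_fwd z)).
    case: z => [v|y] /=; first exact: conn_refl.
    have [g ->] := new_vertexP y; rewrite /= term_act -term_e_out -half_orig_e.
    apply: (@conn_edge half_graph _ (inl (actE g e))).
    by apply: geom_act; exact: geom_refl.
  move=> u v; split=> [E|c].
    apply: conn_trans (to_base u) _; rewrite E; apply: conn_sym (to_base v).
    by case=> // y; exact: geom_rev.
  apply: (@conn_elim half_graph old_edges (fun z => fold_fwd u = fold_fwd z) u v) c erefl.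
  move=> [y|//] /geomP[g H] /=.
  change (fold_fwd u = fold_fwd (half_orig (inl y)) ->
    fold_fwd u = fold_fwd (half_orig (inl (rev y)))) => ->.
  case: H => ->; rewrite ?rev_act ?revK -?rev_act half_orig_e term_e_out /=;
    by rewrite term_act.
- move=> y z; case: (slid_edgeP y) => [g ->|g ->|n];
  case: (slid_edgeP z) => [h ->|h ->|n'] // [] //.
  + by move=> ->.
- move=> [y|[y b]]; split.
  + case=> z; case: slid_edgeP => // n [<-] //.
  + by move=> /= n; exists y; rewrite slid_edge_out.
  + by move=> _ [].
  + move=> _; have [g ->] := new_vertexP y; case: b.
      by exists (rev (actE g e)); exact: slid_edge_rev_e.
    by exists (actE g e); exact: slid_edge_e.
- move=> y; change (slid_edge (@rev X y) = half_rev (slid_edge y)).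
  case: (slid_edgeP y) => [g ->|g ->|n].
  + exact: slid_edge_rev_e.
  + by rewrite revK slid_edge_e.
  + by rewrite slid_edge_out //; move/geom_revE.
- move=> y; change (fold_fwd (half_orig (slid_edge y)) = slid_orig y).
  case: (slid_edgeP y) => [g ->|g ->|n].
  + rewrite slid_orig_out //= => /spread_notin; apply.
    by apply: geom_act; exact: geom_refl.
  + rewrite slid_orig_out /= ?orig_rev // => /spread_notin; apply.
    by apply: geom_rev; apply: geom_act; exact: geom_refl.
  change (fold_fwd (half_orig (inl y)) = slid_orig y).
  case: (movingP y) => [g E|g s Ss E|no ns] /=.
  + by case: n; apply/geomP; exists g; left.
  + by rewrite E slid_orig_in // term_act.
  + by rewrite slid_orig_out.
Qed.

(** Vertices, edges, action and reversal are definitionally those of [X], so quotient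
    maps of [X] can be reused verbatim for [slid]. *)
Definition slid : gtree G :=
  @GTree G slid_graph (@actV G X) (@actE G X) (@actV1 G X) (@actVM G X) (@actE1 G X)
    (@actEM G X) slid_orig_act (@rev_act G X) (@no_inversion G X)
    (quotient_tree fold_fwd_quotient half_tree).

Lemma half_collapse_fwd :
  @is_collapse G half slid (inl e) fold_fwd slid_edge.
Proof.
have ho : @orig half (inl e) = inr (new_vertex 1).
  by rewrite -[in LHS](actE1 e); exact: half_orig_e.
apply/collapse_quotient; split.
  apply/collapsibleP; split.
    rewrite ho half_stab_vertex; apply/seteqP; split=> g; rewrite /stabE /=; first by case.
    by move=> ->.
  rewrite ho; case=> g.
  have -> : @term half (inl e) = inl (term e).
    by rewrite -[in LHS](actE1 e); rewrite [LHS]term_e_out actV1.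
  by [].
have -> : @geom_orbit G half (inl e) = old_edges.
  apply/seteqP; split=> y; first by case/geomP=> g [] -> /=; apply/geomP; exists g; [left|right].
  by case: y => [y|//] /geomP[g [] ->]; apply/geomP; exists g; [left|right].
split; first exact: fold_fwd_quotient.
  by move=> g [v|y] //=; rewrite term_act.
move=> g y; change (slid_edge (@actE G X g y) = half_actE g (slid_edge y)).
case: (slid_edgeP y) => [h ->|h ->|n].
- by rewrite -actEM slid_edge_e half_actE_new.
- by rewrite -rev_act -actEM slid_edge_rev_e half_actE_new.
- by rewrite slid_edge_out //; move/geom_actE.
Qed.

Lemma slide_slid : slide X slid.
Proof.
exists e, S; split.
  move=> s Ss; split; [exact: slidable_orig|exact: slidable_notin|].
  by move=> g h; apply: (slidable_stab sl Ss); rewrite h.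
exists half, new_edge, fold_back, inl; split; last first.
  by exists fold_fwd, slid_edge; exact: half_collapse_fwd.
split.
- exact: half_collapse.
- by rewrite /= actE1.
- exact: half_stab_vertex.
- exact: half_stab_new_edge.
- move=> y My; rewrite -[y](actE1); apply: half_orig_in.
  by case: My => [->|]; [left|right].
- move=> y oy nM.
  have -> : @term half new_edge = inl (orig e) by rewrite /= actE1.
  rewrite -oy; apply: half_orig_out.
  + case=> g E; apply: nM; exists e; first by left.
    by apply/orbitEP; exists g.
  + case=> g [s [Ss E]]; apply: nM; exists s; first by right.
    by apply/orbitEP; exists g.
Qed.

End Slide.

(** * Slides and collapses *)
Section SlideCollapse.
Variable G : groupType.
Implicit Types X Y Z T : gtree G.

Lemma quotient_set_act X Y F (q : vertex X -> vertex Y) i g e :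
  quotient F q i -> F e -> F (actE g e).
Proof.
move=> Q Fe; have [//|[e' E]] := gq_out Q (actE g e).
case: (gq_notin Q (e' := actE g^-1 e')).
by rewrite (quotient_actE Q) -E actEK.
Qed.

Lemma conn_slid X (e : edge X) S (sl : slidable e S) (F : set (edge X)) u v :
  (forall y, F y -> ~ spread S y /\ ~ spread S (rev y)) ->
  @conn (slid sl) F u v <-> conn F u v.
Proof.
move=> hF; split=> c.
  apply: (@conn_elim (slid sl) F (fun z => @conn X F u z) u v) c (conn_refl F u).
  move=> y Fy; have [h1 h2] := hF y Fy.
  change (@conn X F u (slid_orig e S y) -> @conn X F u (slid_orig e S (rev y))).
  rewrite !slid_orig_out // orig_rev => c; exact: conn_trans c (conn_edge Fy).
apply: (@conn_elim X F (fun z => @conn (slid sl) F u z) u v) c (@conn_refl (slid sl) F u).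
move=> y Fy c; have [h1 h2] := hF y Fy.
apply: conn_trans c _.
have := @conn_edge (slid sl) F y Fy.
change (@conn (slid sl) F (slid_orig e S y) (slid_orig e S (rev y)) -> @conn (slid sl) F (orig y) (term y)).
by rewrite !slid_orig_out // orig_rev.
Qed.

Lemma spread_disjoint X Y F (q : vertex X -> vertex Y) i (S : set (edge X)) :
  quotient F q i -> (forall s, S s -> ~ F s) ->
  forall y, F y -> ~ spread S y /\ ~ spread S (rev y).
Proof.
move=> Q nF y Fy; split=> -[g [s [Ss E]]]; apply: (nF s Ss).
  by rewrite -[s](actEK g) -E; exact: (quotient_set_act _ Q).
by rewrite -[s](actEK g) -E; apply: (quotient_set_act _ Q); exact: (gq_revF Q).
Qed.

(** If [e] is contracted, a slide over [e] becomes invisible: its two ends, hence the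
    old and new origins of the sliding edges, are identified. *)
Lemma slid_quotient_absorb X Y F (q : vertex X -> vertex Y) i (e : edge X) S
    (sl : slidable e S) :
  quotient F q i -> F e -> (forall s, S s -> ~ F s) ->
  @quotient G (slid sl) Y F q i.
Proof.
move=> Q Fe nF; split; [|exact: quotient_actV Q|exact: quotient_actE Q].
split; [exact: gq_surj Q| |exact: gq_inj Q|exact: gq_range Q|exact: gq_rev Q|].
  move=> u v; rewrite (gq_fiber Q); apply: iff_sym; apply: conn_slid.
  exact: spread_disjoint Q nF.
move=> y; change (q (slid_orig e S (i y)) = orig y).
have [[g [s [Ss E]]]|n] := pselect (spread S (i y)).
  rewrite E slid_orig_in // (quotient_actV Q) -(gq_contract Q Fe) -(slidable_orig sl Ss).
  by rewrite -(quotient_actV Q) -orig_act -E (gq_orig Q).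
by rewrite slid_orig_out // (gq_orig Q).
Qed.

Lemma slidable_quotient X Y F (q : vertex X -> vertex Y) i (e : edge X) S eY :
  quotient F q i -> i eY = e -> slidable e S -> slidable eY [set y | S (i y)].
Proof.
move=> Q E sl; split.
- by move=> s Ss; rewrite -!(gq_orig Q) (slidable_orig sl Ss) E.
- by move=> s Ss; rewrite -(quotient_geom Q) E; exact: slidable_notin sl _ Ss.
- move=> s g /= Ss; rewrite (quotient_actE Q) -(quotient_stabE Q) E.
  exact: slidable_stab.
Qed.

Lemma slid_quotient X Y F (q : vertex X -> vertex Y) i (e : edge X) S eY
    (sl : slidable e S) (slY : slidable eY [set y | S (i y)]) :
  quotient F q i -> i eY = e -> (forall s, S s -> ~ F s) ->
  @quotient G (slid sl) (slid slY) F q i.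
Proof.
move=> Q Ee nF; split; [|exact: quotient_actV Q|exact: quotient_actE Q].
split; [exact: gq_surj Q| |exact: gq_inj Q|exact: gq_range Q|exact: gq_rev Q|].
  move=> u v; rewrite (gq_fiber Q); apply: iff_sym; apply: conn_slid.
  exact: spread_disjoint Q nF.
move=> y; change (q (slid_orig e S (i y)) = slid_orig eY [set y | S (i y)] y).
have [[g [s [Ss E]]]|n] := pselect (spread S (i y)).
  have Es : i (actE g^-1 y) = s by rewrite (quotient_actE Q) E actEK.
  rewrite E slid_orig_in // (quotient_actV Q) -Ee (gq_term Q).
  rewrite -[y in RHS](actEKV g) slid_orig_in //=; by rewrite Es.
rewrite !slid_orig_out ?(gq_orig Q) // => -[g [s [Ss E]]]; apply: n.
by exists g, (i s); split=> //; rewrite E (quotient_actE Q).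
Qed.

(** At the small end of [e] any edges may slide: an element moving one to another
    fixes their common origin, hence [e]. *)
Lemma slidable_small X (e : edge X) S : stabE e = stabV (orig e) ->
  (forall s, S s -> orig s = orig e /\ ~ geom_orbit e s) -> slidable e S.
Proof.
move=> he hS; split=> [s /hS[]|s /hS[]|s g /hS[E _] /hS[]] //.
by rewrite orig_act E he.
Qed.

Lemma slidable_loop X (e : edge X) S (sl : slidable e S) y :
  orbV (orig e) (term e) -> orbV (orig y) (slid_orig e S y).
Proof.
move=> l; have [[g [s [Ss ->]]]|n] := pselect (spread S y).
  rewrite slid_orig_in // orig_act (slidable_orig sl Ss).
  apply: orbV_trans (orbV_sym (orbV_act _ g)) _; apply: orbV_trans l (orbV_act _ g).
by rewrite slid_orig_out //; exact: orbV_refl.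
Qed.

(** Sliding over a loop changes neither the orbits of endpoints nor, therefore, which
    edges are loops. A sliding edge that became collapsible would have the group of
    [term e], although its group lies in that of [orig e]. *)
Lemma slid_loop_reduced X (e : edge X) S (sl : slidable e S) :
  reduced X -> orbV (orig e) (term e) -> ~ (stabV (term e) `<=` stabV (orig e)) ->
  reduced (slid sl).
Proof.
move=> rX l ns y /collapsibleP[].
change (@stabE G X y = @stabV G X (slid_orig e S y) ->
  ~ @orbV G X (slid_orig e S y) (slid_orig e S (rev y)) -> False).
have [[g [s [Ss E]]]|n] := pselect (spread S y).
  rewrite E slid_orig_in // => hs _; apply: ns => h ht.
  have : stabE (actE g s) (g * h * g^-1).
    by rewrite hs; apply/stabV_act; rewrite conj_cancel.
  move/stabE_act; rewrite conj_cancel => /stabE_orig.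
  by rewrite (slidable_orig sl Ss).
rewrite slid_orig_out // => hs nl; apply: (rX y); apply/collapsibleP; split=> // h.
apply: nl; apply: orbV_trans h _; rewrite -orig_rev.
exact: slidable_loop.
Qed.

(** In [X/a] the edge [b] starts at the merged vertex, and [X] is its expansion there
    in which [b] and all other edges at [orig a] are moved. *)
Lemma slide_of_two X Y1 Y2 (a b : edge X) (q1 : vertex X -> vertex Y1) i1
    (q2 : vertex X -> vertex Y2) i2 :
  is_collapse a q1 i1 -> is_collapse b q2 i2 -> orig a = orig b ->
  ~ geom_orbit a b -> slide Y1 Y2.
Proof.
move=> c1 c2 ab nab; have [ca Q1] := (collapse_quotient _ _ _).1 c1.
have [[sa nla] [sb nlb]] := ((collapsibleP a).1 ca, (collapsibleP b).1 (collapse_collapsible c2)).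
have [e Ee] := (gq_range Q1 b).2 nab.
have se : stabE e = stabV (orig a) by rewrite -(quotient_stabE Q1) Ee sb ab.
have oe : orig e = q1 (orig a) by rewrite -(gq_orig Q1) Ee ab.
exists e, [set s | orig (i1 s) = orig a /\ ~ geom_orbit e s]; split.
  move=> s [os ns]; split=> //.
    by rewrite -!(gq_orig Q1) os Ee ab.
  by rewrite se -os -(quotient_stabE Q1); exact: stabE_orig.
exists X, a, q1, i1; split; last by rewrite Ee; exists q2, i2.
split=> //.
- by rewrite se sa.
- by move=> y [->|[]] //; rewrite Ee ab.
move=> y oy ny.
have E : q1 (orig (i1 y)) = q1 (term a).
  by rewrite (gq_orig Q1) oy oe (collapse_contract Q1).
have [//|[g [Eg _]]] := collapse_eq ca Q1 nla E.
case: ny.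
have oy' : orig (i1 (actE g^-1 y)) = orig a.
  by rewrite (quotient_actE Q1) orig_act Eg actVK.
have [/geomP[h H]|n] := pselect (geom_orbit e (actE g^-1 y)); last first.
  exists (actE g^-1 y); first by right.
  by apply/orbitEP; exists g; rewrite actEKV.
exists e; [by left|apply/orbitEP; exists (g * h)].
case: H => E'; first by rewrite actEM -E' actEKV.
case: nlb; exists h^-1; rewrite -ab -oy' E' (quotient_actE Q1) (gq_rev Q1) Ee.
by rewrite orig_act orig_rev actVK.
Qed.

End SlideCollapse.

(** * Reduction to a reduced tree *)
Section Reductions.
Variable G : groupType.
Implicit Types X Y Z T R : gtree G.

(** The new edge and the edge slid over play symmetric roles in the middle tree. *)
Lemma slide_sym X Y : slide X Y -> slide Y X.
Proof.
case=> e [S [hS [H [d [q [i [E [q' [i' C']]]]]]]]].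
have [C _ hK hd hM _] := E.
have oe : orig (i e) = orig d by apply: hM; left.
apply: (slide_of_two C' C oe); rewrite -/(@geom_orbit G H _).
by move/geom_sym; apply: (gq_notin ((collapse_quotient _ _ _).1 C).2).
Qed.

Lemma related_refl X : related_by_moves X X.
Proof. exact: rt_refl. Qed.

Lemma related_trans X Y Z :
  related_by_moves X Y -> related_by_moves Y Z -> related_by_moves X Z.
Proof. exact: rt_trans. Qed.

Lemma related_sym X Y : related_by_moves X Y -> related_by_moves Y X.
Proof.
elim=> [A B [rA rB m]|A|A B C _ BA _ CB]; last 2 first.
- exact: related_refl.
- exact: related_trans CB BA.
apply: rt_step; split=> //; case: m => m.
- by apply: Move_iso; exact: iso_sym.
- by apply: Move_slide; exact: slide_sym.
- by apply: Move_induction; case: m; [right|left].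
- by apply: Move_A_inv.
- by apply: Move_A.
Qed.

Lemma reduced_iso X Y : gtree_iso X Y -> reduced X -> reduced Y.
Proof.
by move/iso_quotient=> [q [i Q]] rX e /(collapsible_lift Q); exact: rX.
Qed.

Lemma related_iso X Y : gtree_iso X Y -> reduced X -> related_by_moves X Y.
Proof.
move=> I rX; apply: rt_step; split=> //; first exact: reduced_iso rX.
exact: Move_iso.
Qed.

Lemma iso_collapse X X' Y : gtree_iso X X' -> collapse_move X' Y -> collapse_move X Y.
Proof.
move/iso_quotient=> [q [i Q]] [d [q' [i' /collapse_quotient[cd Q']]]].
exists (i d), (q' \o q), (i \o i'); apply/collapse_quotient.
split; first exact: (collapsible_lift Q).
by have := quotient_comp Q Q'; rewrite set0U (quotient_geom_image Q).
Qed.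

(** Isomorphisms are only needed at the end, because a collapse can absorb one. *)
Inductive reduces X R : Prop :=
| Reduces_iso of gtree_iso X R
| Reduces_step Y of collapse_move X Y & reduces Y R.

Lemma reduces_iso X X' R : gtree_iso X X' -> reduces X' R -> reduces X R.
Proof.
move=> I; case=> [I'|Y c h]; first by apply: Reduces_iso; exact: iso_trans I I'.
by apply: (Reduces_step (Y := Y)) => //; exact: iso_collapse I c.
Qed.

Definition equi_reducible Y Z : Prop := forall R R', reduces Y R -> reduced R ->
  reduces Z R' -> reduced R' -> related_by_moves R R'.

Definition reducible Y : Prop := exists2 R, reduces Y R & reduced R.

Lemma equi_sym Y Z : equi_reducible Y Z -> equi_reducible Z Y.
Proof. by move=> h R R' *; apply: related_sym; apply: h. Qed.

(** A reduction of the middle tree has to exist, otherwise the relation through it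
    is vacuous. *)
Lemma equi_trans Y Z W : reducible Z ->
  equi_reducible Y Z -> equi_reducible Z W -> equi_reducible Y W.
Proof.
move=> [R1 h1 r1] h h' R R' hR rR hR' rR'.
by apply: related_trans (h R R1 _ _ _ _) (h' R1 R' _ _ _ _).
Qed.

Lemma reduced_no_step X Y : reduced X -> ~ collapse_move X Y.
Proof. by move=> rX [d [q [i /collapse_quotient[/rX]]]]. Qed.

Lemma equi_reduced X Y : reduced X -> reduced Y -> related_by_moves X Y ->
  equi_reducible X Y.
Proof.
move=> rX rY XY R R' [I|Z /(reduced_no_step rX)//] rR [I'|Z /(reduced_no_step rY)//] rR'.
apply: related_trans (related_iso (iso_sym I) rR) _.
by apply: related_trans XY (related_iso I' rY).
Qed.

Lemma equi_reduces X Y Z : reduced Z -> equi_reducible X X -> reduces X Z ->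
  reduced Y -> related_by_moves Y Z -> equi_reducible Y X.
Proof.
move=> rZ XX XZ rY YZ R R' [I|W /(reduced_no_step rY)//] rR hR' rR'.
apply: related_trans (related_iso (iso_sym I) rR) _.
by apply: related_trans YZ (XX _ _ _ _ _ _).
Qed.

(** If [c] can be collapsed after [a], then [a] can be collapsed after [c], with the
    same result. Either [orig a] keeps its group in [X/c], or [orig a] and the origin
    of [c] agree, in which case [a] is small at both ends and its reverse is used. *)
Lemma collapse_comm X Y Z (a : edge X) (q : vertex X -> vertex Y) i c
    (q2 : vertex X -> vertex Z) i2 :
  is_collapse a q i -> collapsible c -> is_collapse (i c) q2 i2 ->
  exists2 W, collapse_move Y W & collapse_move Z W.
Proof.
move=> C1 cc C2.
have [[ca Q1] [cic Q2]] := ((collapse_quotient _ _ _).1 C1, (collapse_quotient _ _ _).1 C2).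
have [W [r [j C3]]] := collapse_exists cc.
have [_ Q3] := (collapse_quotient _ _ _).1 C3.
exists W; first by exists c, r, j.
have Q13 := quotient_comp Q1 Q3.
rewrite (quotient_geom_image Q1) in Q13.
have [|r' [j' [Q4 _ _]]] := quotient_factor Q2 Q13; first by move=> f; right.
have nac : ~ geom_orbit (i c) a.
  by move/geom_sym; exact: (gq_notin Q1).
have [a2 Ea2] := (gq_range Q2 a).2 nac.
have FE : [set e | (geom_orbit a `|` geom_orbit (i c)) (i2 e)] = geom_orbit a2.
  apply/seteqP; split=> e /=.
    by case; [rewrite -Ea2 => /(quotient_geom Q2)|move/(gq_notin Q2)].
  by move/(quotient_geom Q2); rewrite Ea2; left.
rewrite FE in Q4.
have [sc nlc] := (collapsibleP c).1 cc.
have [sic nlic] := (collapsibleP _).1 cic.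
have [sa nla] := (collapsibleP a).1 ca.
(* If collapsing [c] made [a] a loop, the two would be parallel, and [c] a loop in [Y]. *)
have noloop : ~ orbV (q2 (orig a)) (q2 (term a)).
  case/(collapse_orbV cic Q2) => [//|[h1 h2]|[h1 h2]|[h1 h2]].
  - apply: nlc; have := quotient_orbV Q1 (orbV_trans h1 (orbV_refl _)).
    rewrite (gq_orig Q1) => h; apply: orbV_trans h _.
    rewrite (collapse_contract Q1); apply: orbV_sym.
    by have := quotient_orbV Q1 h2; rewrite (gq_term Q1).
  - apply: nlc; have := quotient_orbV Q1 h2.
    rewrite (gq_orig Q1) => h; apply: orbV_trans h _.
    rewrite -(collapse_contract Q1); apply: orbV_sym.
    by have := quotient_orbV Q1 h1; rewrite (gq_term Q1).
  by apply: nla; exact: orbV_trans (orbV_sym h1) h2.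
suff [a3 Ea3 ca3] : exists2 a3, geom_orbit a3 = geom_orbit a2 & collapsible a3.
  by exists a3, r', j'; apply/collapse_quotient; rewrite Ea3.
have [[g Eg]|n] := pselect (orbV (orig (i c)) (orig a)); last first.
  exists a2 => //; apply/collapsibleP; rewrite -(gq_orig Q2) -(gq_term Q2) Ea2.
  by rewrite (collapse_stabV cic Q2 n) -(quotient_stabE Q2) Ea2.
exists (rev a2); first exact: geom_revl.
apply/collapsibleP; rewrite orig_rev term_rev -(gq_orig Q2) -(gq_term Q2) Ea2.
split; last by move/orbV_sym.
have nt : ~ orbV (orig (i c)) (term a).
  by move=> h; apply: nla; apply: orbV_trans h; exists g^-1; rewrite Eg actVK.
have [sra _] := (collapsibleP _).1 (collapsible_rev ca Q1 cc (orbV_sym (ex_intro _ g Eg))).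
by rewrite (collapse_stabV cic Q2 nt) stabE_rev -(quotient_stabE Q2) Ea2 -stabE_rev sra orig_rev.
Qed.

End Reductions.

(** * Termination of reduction *)
Section Measure.
Variable G : groupType.
Implicit Types X Y Z T R : gtree G.

(** [P] meets at most [n] orbits. Removing orbits one by one avoids enumerating the
    orbits, of which there may be infinitely many outside [P]. *)
Fixpoint covered X (P : set (vertex X)) (n : nat) : Prop :=
  if n is m.+1 then
    (forall v, ~ P v) \/ exists2 v, P v & covered (P `\` orbV v) m
  else forall v, ~ P v.

(** A relation that carries orbits to orbits transports a bound on their number; it
    need not be a map, so it can be used along a collapse in both directions. *)
Lemma covered_map X Y (P : set (vertex X)) (P' : set (vertex Y))
    (r : vertex X -> vertex Y -> Prop) n :
  (forall v', P' v' -> exists2 v, P v & r v v') ->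
  (forall u v u' v', r u u' -> r v v' -> orbV u v -> orbV u' v') ->
  covered P n -> covered P' n.
Proof.
move=> + hr; elim: n P P' => [|n IH] P P' hP /=.
  by move=> h v' /hP[v /h].
case=> [h|[v Pv h]]; first by left=> v' /hP[v /h].
have [[v' [Pv' [u ruv' uv]]]|no] :=
    pselect (exists v', P' v' /\ exists2 u, r u v' & orbV v u).
  right; exists v' => //; apply: IH h => w' [Pw' nw'].
  have [w Pw rw] := hP _ Pw'; exists w => //; split=> // vw; apply: nw'.
  by apply: hr ruv' rw _; apply: orbV_trans (orbV_sym uv) vw.
have [[v' Pv']|none] := pselect (exists v', P' v'); last first.
  by left=> v' Pv'; apply: none; exists v'.
right; exists v' => //; apply: IH h => w' [Pw' _].
have [w Pw rw] := hP _ Pw'; exists w => //; split=> // vw.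
by apply: no; exists w'; split=> //; exists w.
Qed.

Lemma covered_subset X (P P' : set (vertex X)) n :
  P' `<=` P -> covered P n -> covered P' n.
Proof.
move=> h; apply: (covered_map (r := eq)) => [v /h|u v u' v' -> ->] //.
by exists v.
Qed.

Lemma covered_remove X (P : set (vertex X)) w n :
  P w -> covered P n -> exists2 m, n = m.+1 & covered (P `\` orbV w) m.
Proof.
elim: n P => [|n IH] P Pw /=; first by move/(_ w).
case=> [/(_ w) //|[v Pv h]]; exists n => //.
have [vw|nvw] := pselect (orbV v w).
  apply: covered_subset h => u [Pu nu]; split=> // vu; apply: nu.
  exact: orbV_trans (orbV_sym vw) vu.
have [|m -> hm] := IH (P `\` orbV v) _ h; first by split.
right; exists v; first by split=> // /orbV_sym.
by apply: covered_subset hm => u [[Pu h1] h2].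
Qed.

Definition small X : set (vertex X) := [set v | exists2 e, collapsible e & orig e = v].

Lemma small_iso X Y n : gtree_iso X Y -> covered (@small X) n -> covered (@small Y) n.
Proof.
move/iso_quotient=> [q [i Q]]; apply: (covered_map (r := fun v v' => q v = v')).
  move=> v' [e ce <-]; exists (orig (i e)); last exact: (gq_orig Q).
  by exists (i e) => //; exact: (collapsible_lift Q).
by move=> u v _ _ <- <-; exact: (quotient_orbV Q).
Qed.

(** The orbit of [orig a] disappears, and a vertex of the quotient that is small was
    already small upstairs: if its collapsible edge came from [orig a], then [a] is
    small at both ends and [term a] can be taken. *)
Lemma small_collapse X Y n : collapse_move X Y -> covered (@small X) n ->
  exists2 m, n = m.+1 & covered (@small Y) m.
Proof.
move=> [a [q [i /collapse_quotient[ca Q]]]] h.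
have [|m En {}h] := covered_remove (w := orig a) _ h; first by exists a.
exists m => //; apply: (covered_map (r := fun v v' => q v = v')) h => [v' [c cc <-]|u v u' v' /= E1 E2].
  2: by move=> uv; rewrite -E1 -E2; exact: (quotient_orbV Q).
have [[g Eg]|n'] := pselect (orbV (orig a) (orig (i c))); last first.
  exists (orig (i c)); last exact: (gq_orig Q).
  split=> //; exists (i c) => //; exact: (collapsible_lift Q).
have [sa nla] := (collapsibleP a).1 ca.
have ->: orig c = q (actV g (term a)).
  by rewrite -(gq_orig Q) Eg !(quotient_actV Q) (collapse_contract Q).
exists (actV g (term a)) => //; split; last first.
  by move=> h'; apply: nla; apply: orbV_trans h' (orbV_sym (orbV_act _ g)).
exists (actE g (rev a)); last by rewrite orig_act orig_rev.
apply: collapsible_act; apply: (collapsible_rev ca Q cc); by exists g.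
Qed.

(** A small vertex away from the two ends of [a] is unaffected by its collapse, so at
    most the orbits of these two ends are new. *)
Lemma small_expand X Y n : collapse_move X Y -> covered (@small Y) n ->
  exists m, covered (@small X) m.
Proof.
move=> [a [q [i /collapse_quotient[ca Q]]]] h.
pose P := @small X `\` orbV (orig a) `\` orbV (term a).
have hP : covered P n.
  apply: (covered_map (r := fun v' v => v' = q v /\ ~ orbV (orig a) v /\ ~ orbV (term a) v)) h.
    move=> v [[[e ce oe] n1] n2]; exists (q v) => //.
    have [se nle] := (collapsibleP e).1 ce; rewrite -oe in n1 n2 *.
    have ne : ~ geom_orbit a e.
      case/geomP=> g [] E; [apply: n1|apply: n2]; exists g.
        by rewrite E orig_act.
      by rewrite E orig_act orig_rev.
    have [e' Ee] := (gq_range Q e).2 ne; exists e'; last by rewrite -(gq_orig Q) Ee.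
    apply/collapsibleP; rewrite -(gq_orig Q) -(gq_term Q) Ee.
    rewrite -(quotient_stabE Q) Ee (collapse_stabV ca Q n1); split=> //.
    by case/(collapse_orbV ca Q)=> [|[]|[]|[]].
  move=> _ _ u v [-> [n1 n2]] [-> [n3 n4]].
  by case/(collapse_orbV ca Q)=> [|[]|[]|[]].
have add w (P' : set (vertex X)) k : covered (P' `\` orbV w) k -> covered P' k.+1.
  move=> hk; have [[u [Pu wu]]|no] := pselect (exists u, P' u /\ orbV w u).
    right; exists u => //; apply: covered_subset hk => z [Pz nz]; split=> // wz.
    by apply: nz; exact: orbV_trans (orbV_sym wu) wz.
  have {}hk : covered P' k.
    by apply: covered_subset hk => z Pz; split=> // wz; apply: no; exists z.
  elim: k P' hk {no} => [|k IH] P' /= hk; first by left.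
  case: hk => [|[v Pv hv]]; first by left.
  by right; exists v => //; exact: IH.
by exists n.+2; apply: (add (orig a)); apply: (add (term a)).
Qed.

Lemma covered_reducible X n : covered (@small X) n -> reducible X.
Proof.
elim: n X => [|n IH] X h.
  exists X; first by apply: Reduces_iso; exact: iso_refl.
  by move=> e ce; apply: (h (orig e)); exists e.
have [rX|] := pselect (reduced X).
  by exists X => //; apply: Reduces_iso; exact: iso_refl.
move=> /existsNP[e /contrapT ce].
have [Y [q [i c]]] := collapse_exists ce.
have cm : collapse_move X Y by exists e, q, i.
have [m [<-] hY] := small_collapse cm h.
have [R hR rR] := IH Y hY.
by exists R => //; exact: Reduces_step cm hR.
Qed.

End Measure.

(** * Comparison of two collapses of one tree *)
Section SlidExtra.
Variables (G : groupType) (X : gtree G).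

Lemma geom_not_spread (S : set (edge X)) d y :
  (forall s, S s -> ~ geom_orbit d s) -> geom_orbit d y -> ~ spread S y.
Proof.
by move=> h dy [g [s [Ss E]]]; apply: (h s Ss); apply/(geom_actE _ _ g); rewrite -E.
Qed.

Lemma collapsible_slid (e : edge X) S (sl : slidable e S) d :
  (forall s, S s -> ~ geom_orbit d s) -> collapsible d -> @collapsible G (slid sl) d.
Proof.
move=> h /collapsibleP[h1 h2]; apply/collapsibleP.
change (@stabE G X d = @stabV G X (slid_orig e S d) /\
  ~ @orbV G X (slid_orig e S d) (slid_orig e S (rev d))).
rewrite !slid_orig_out ?orig_rev //; apply: (geom_not_spread h); last exact: geom_refl.
by apply: geom_rev; exact: geom_refl.
Qed.

Variables (Y : gtree G) (a : edge X) (q : vertex X -> vertex Y) (i : edge Y -> edge X).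
Hypotheses (ca : collapsible a) (Q : quotient (geom_orbit a) q i).

(** If [orig b] is outside the orbit of [orig a], it keeps its group in [X/a], so [b]
    can only cease to be collapsible by becoming a loop, and then it is parallel to
    [a] with opposite origin. *)
Lemma collapse_trichotomy b : collapsible b -> ~ geom_orbit a b ->
  [\/ exists2 b', i b' = b & collapsible b',
      orbV (orig a) (orig b)
    | orbV (term a) (orig b) /\ orbV (orig a) (term b)].
Proof.
move=> cb nab; have [sb nlb] := (collapsibleP b).1 cb.
have [S|nS] := pselect (orbV (orig a) (orig b)); first by apply: Or32.
have [b' Eb] := (gq_range Q b).2 nab.
have [I|nI] := pselect (orbV (term a) (orig b) /\ orbV (orig a) (term b)).
  by apply: Or33.
apply: Or31; exists b' => //; apply/collapsibleP.
rewrite -(quotient_stabE Q) -(gq_orig Q) -(gq_term Q) Eb (collapse_stabV ca Q nS).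
by split=> // /(collapse_orbV ca Q)[|[]|/nI|[]].
Qed.

End SlidExtra.

Section Compare.
Variables (G : groupType) (X : gtree G).
(** The induction hypothesis: every proper collapse of [X] has been dealt with. *)
Hypothesis HX : forall Y, collapse_move X Y ->
  equi_reducible Y Y /\ exists n, covered (@small G Y) n.
Implicit Types (Y Z W : gtree G) (a b c e f : edge X).

Definition collapses_to a Y : Prop := exists q i, @is_collapse G X Y a q i.

Lemma collapses_to_move a Y : collapses_to a Y -> collapse_move X Y.
Proof. by case=> q [i c]; exists a, q, i. Qed.

Lemma collapses_to_reducible a Y : collapses_to a Y -> reducible Y.
Proof. by move/collapses_to_move/HX => [_ [n]]; exact: covered_reducible. Qed.

Lemma collapses_to_equi a Y : collapses_to a Y -> equi_reducible Y Y.
Proof. by move/collapses_to_move/HX => []. Qed.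

Definition similar a b : Prop :=
  forall Y Z, collapses_to a Y -> collapses_to b Z -> equi_reducible Y Z.

Lemma similar_sym a b : similar a b -> similar b a.
Proof. by move=> h Y Z hY hZ; apply: equi_sym; exact: h. Qed.

Lemma similar_trans b a c : collapsible b -> similar a b -> similar b c -> similar a c.
Proof.
move=> /collapse_exists[Y bY] ab bc Z W hZ hW.
apply: (@equi_trans _ _ Y); [exact: collapses_to_reducible bY|exact: ab|exact: bc].
Qed.

Lemma similar_geom a b : geom_orbit a b -> similar a b.
Proof.
move=> ab Y Z hY [q [i /collapse_quotient[cb Q]]] R R' hR rR hR' rR'.
have eY := collapses_to_equi hY; case: hY => [q' [i' /collapse_quotient[ca Q']]].
apply: eY => //; apply: reduces_iso hR'; rewrite (geom_eq ab) in Q.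
exact: quotient_unique Q' Q.
Qed.

(** [X/a] and [X/c] have a common collapse, and its reductions are reductions of both. *)
Lemma similar_collapse a Y (q : vertex X -> vertex Y) i (c : edge Y) :
  is_collapse a q i -> collapsible c -> similar a (i c).
Proof.
move=> C cc Y1 Z h1 h2.
have aY : collapses_to a Y by exists q, i.
apply: (@equi_trans _ _ Y); first exact: collapses_to_reducible aY.
  by apply: (similar_geom (geom_refl a)).
case: (h2) => [q2 [i2 C2]]; have [W YW ZW] := collapse_comm C cc C2.
have [_ [n hn]] := HX (collapses_to_move aY).
have [m _ hm] := small_collapse YW hn.
apply: (@equi_trans _ _ W); first exact: covered_reducible hm.
- by move=> R R' hR rR hR' rR'; apply: (collapses_to_equi aY) => //; exact: Reduces_step YW hR'.
- by move=> R R' hR rR hR' rR'; apply: (collapses_to_equi h2) => //; exact: Reduces_step ZW hR.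
Qed.

Lemma similar_trichotomy a b : collapsible a -> collapsible b ->
  [\/ similar a b, orbV (orig a) (orig b)
    | orbV (term a) (orig b) /\ orbV (orig a) (term b)].
Proof.
move=> ca cb; have [ab|nab] := pselect (geom_orbit a b).
  by apply: Or31; exact: similar_geom.
have [Y [q [i C]]] := collapse_exists ca.
have [_ Q] := (collapse_quotient _ _ _).1 C.
case: (collapse_trichotomy ca Q cb nab) => [[b' <- cb']|S|I].
- by apply: Or31; exact: (similar_collapse C cb').
- exact: Or32.
- exact: Or33.
Qed.

(** ** The A-move

    The edges [f] and [b] leave [w] for [x] and [z], and [e] goes from [z] back to a
    translate of [w]. In the reduced tree [Y = X/b] the edge [e] is an ascending loop
    at the image of [z]. The slides are made in [X] and in [Y] at the same time. *)
Section AMove.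
Variables (f b e : edge X) (t : G) (Y : gtree G).
Variables (q : vertex X -> vertex Y) (i : edge Y -> edge X).
Hypotheses (cf : collapsible f) (ce : collapsible e) (C : is_collapse b q i).
Hypotheses (ofb : orig f = orig b) (oe : orig e = term b).
Hypotheses (te : term e = actV t (orig b)) (nx : ~ orbV (term b) (term f)).
Hypotheses (nbe : ~ geom_orbit b e) (rY : reduced Y).

Let w := orig b.
Let z := term b.
Let x := term f.

Let cb : collapsible b. Proof. exact: collapse_collapsible C. Qed.
Let Q : quotient (geom_orbit b) q i.
Proof. exact: ((collapse_quotient _ _ _).1 C).2. Qed.
Let sb : stabE b = stabV w. Proof. exact: ((collapsibleP b).1 cb).1. Qed.
Let sf : stabE f = stabV w. Proof. by rewrite /w -ofb; exact: ((collapsibleP f).1 cf).1. Qed.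
Let se : stabE e = stabV z. Proof. by rewrite /z -oe; exact: ((collapsibleP e).1 ce).1. Qed.
Let nwz : ~ orbV w z. Proof. exact: ((collapsibleP b).1 cb).2. Qed.
Let nwx : ~ orbV w x. Proof. by rewrite /w -ofb; exact: ((collapsibleP f).1 cf).2. Qed.
Let qwz : q w = q z. Proof. exact: collapse_contract Q. Qed.

Let nbf : ~ geom_orbit b f.
Proof.
case/geomP=> g [] E; apply: nx.
  by exists g; rewrite -term_act -E.
by case: nwz; exists g^-1; rewrite /w -ofb E orig_act orig_rev actVK.
Qed.

Let nef : ~ geom_orbit e f.
Proof.
case/geomP=> g [] E.
  by apply: nwz; exists g^-1; rewrite /w -ofb E orig_act oe actVK.
by apply: nx; exists g; rewrite -oe E term_act term_rev.
Qed.

Let loopless : ~ orbV (q w) (q x).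
Proof. by case/(collapse_orbV cb Q)=> [|[_]|[_]|[_]]. Qed.

Let eY_ex : {eY | i eY = e}. Proof. by apply: cid; apply/(gq_range Q). Qed.
Let fY_ex : {fY | i fY = f}. Proof. by apply: cid; apply/(gq_range Q). Qed.
Let eY := sval eY_ex.
Let fY := sval fY_ex.
Let eYE : i eY = e. Proof. exact: svalP eY_ex. Qed.
Let fYE : i fY = f. Proof. exact: svalP fY_ex. Qed.

(* Otherwise [f] would be collapsible in [Y]. *)
Let stab_z_large : ~ (stabV z `<=` stabV w).
Proof.
move=> h; apply: (rY (e := fY)); apply/collapsibleP.
rewrite -(gq_orig Q) -(gq_term Q) -(quotient_stabE Q) fYE sf ofb; split=> //.
rewrite -/w qwz (collapse_stabV cb Q nwz); apply/seteqP; split=> //.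
by rewrite -sb; exact: stabE_term.
Qed.

(* Otherwise the reverse of [f] would be. *)
Let stab_x_large : ~ (stabV x `<=` stabV w).
Proof.
move=> h; apply: (rY (e := rev fY)); apply/collapsibleP.
rewrite orig_rev term_rev stabE_rev -(gq_orig Q) -(gq_term Q) -(quotient_stabE Q) fYE sf ofb.
split; last by move/orbV_sym.
rewrite (collapse_stabV cb Q nwx); apply/seteqP; split=> //.
by rewrite -sf; exact: stabE_term.
Qed.

(* The other edges at [z] slide over [e] to the orbit of [w]. In [Y] this is a slide
   over the loop, which brings their groups into that of [w]. *)
Let S1 : set (edge X) := [set s | [/\ orig s = z, ~ geom_orbit e s,
  ~ geom_orbit b s & ~ geom_orbit f s]].
Let S1e s : S1 s -> ~ geom_orbit e s. Proof. by case. Qed.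
Let S1b s : S1 s -> ~ geom_orbit b s. Proof. by case. Qed.
Let S1f s : S1 s -> ~ geom_orbit f s. Proof. by case. Qed.
Let sl1 : slidable e S1.
Proof. by apply: slidable_small; [rewrite se oe|move=> s []; rewrite oe]. Qed.
Let X1 := slid sl1.
Let o1 := slid_orig e S1.
Let o1E d y : (forall s, S1 s -> ~ geom_orbit d s) -> geom_orbit d y -> o1 y = orig y.
Proof. by move=> h dy; apply: slid_orig_out; exact: geom_not_spread h dy. Qed.

Let slY1 : slidable eY [set y | S1 (i y)].
Proof. exact: slidable_quotient Q eYE sl1. Qed.
Let Y1 := slid slY1.
Let Q1 : @quotient G X1 Y1 (geom_orbit b) q i.
Proof. exact: slid_quotient Q eYE S1b. Qed.

(* All edges now at [w], except [e], [b] and [f], slide over [f] to [x]. In [Y] this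
   frees the vertex of the loop. *)
Let S2 : set (edge X) := [set s | [/\ o1 s = w, ~ geom_orbit e s,
  ~ geom_orbit b s & ~ geom_orbit f s]].
Let S2e s : S2 s -> ~ geom_orbit e s. Proof. by case. Qed.
Let S2b s : S2 s -> ~ geom_orbit b s. Proof. by case. Qed.
Let S2f s : S2 s -> ~ geom_orbit f s. Proof. by case. Qed.
Let o1f : o1 f = w. Proof. by rewrite (o1E S1f (geom_refl f)) ofb. Qed.
Let sl2 : @slidable G X1 f S2.
Proof.
apply: slidable_small; change (@orig X1) with o1; rewrite o1f; first exact: sf.
by move=> s [].
Qed.
Let X2 := slid sl2.
Let o2 := @slid_orig G X1 f S2.
Let o2E d y : (forall s, S2 s -> ~ geom_orbit d s) -> geom_orbit d y -> o2 y = o1 y.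
Proof. by move=> h dy; apply: slid_orig_out; exact: (@geom_not_spread G X1 _ d _ h dy). Qed.
Let o2b y : geom_orbit b y -> o2 y = orig y.
Proof. by move=> h; rewrite (o2E S2b h) (o1E S1b h). Qed.
Let o2e y : geom_orbit e y -> o2 y = orig y.
Proof. by move=> h; rewrite (o2E S2e h) (o1E S1e h). Qed.
Let o2f y : geom_orbit f y -> o2 y = orig y.
Proof. by move=> h; rewrite (o2E S2f h) (o1E S1f h). Qed.

Let slY2 : @slidable G Y1 fY [set y | S2 (i y)].
Proof. exact: slidable_quotient Q1 fYE sl2. Qed.
Let Y2 := slid slY2.
Let Q2 : @quotient G X2 Y2 (geom_orbit b) q i.
Proof. exact: slid_quotient Q1 fYE S2b. Qed.

(* Every other edge at [z] or [w] has been set in motion by one of the two slides. *)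
Let hub y : orbV w (o1 y) \/ orbV z (o1 y) ->
  [\/ @spread G X1 S2 y, geom_orbit b y, geom_orbit e y | geom_orbit f y].
Proof.
move=> h.
have [by_|nb] := pselect (geom_orbit b y); first exact: Or42.
have [ey|ne] := pselect (geom_orbit e y); first exact: Or43.
have [fy|nf] := pselect (geom_orbit f y); first exact: Or44.
apply: Or41.
have [[g E]|nw] := pselect (orbV w (o1 y)).
  exists g, (actE g^-1 y); split; last by rewrite actEKV.
  split; try by move/geom_actE.
  by rewrite /o1 (slid_orig_act sl1) -/o1 E actVK.
case: h => [//|[g E]].
have ns : ~ spread S1 y.
  case=> k [s [Ss Es]]; case: nw; exists (k * t).
  by rewrite /o1 Es (slid_orig_in sl1) // te actVM.
case: (ns); exists g, (actE g^-1 y); split; last by rewrite actEKV.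
split; try by move/geom_actE.
by rewrite orig_act -(slid_orig_out e ns) -/o1 E actVK.
Qed.

Let eYloop : orbV (orig eY) (term eY).
Proof.
rewrite -(gq_orig Q) -(gq_term Q) eYE oe te -/w -/z -qwz.
by apply: (quotient_orbV Q); exact: orbV_act.
Qed.

Let sA g : stabV z g -> stabV w (monodromy t g).
Proof. by rewrite -se => /stabE_term; rewrite te => /stabV_act. Qed.

(* If the group of [term eY] lay in that of [orig eY], conjugating by [t] and back would
   put the group of [z] inside that of [w]. *)
Let rY1 : reduced Y1.
Proof.
apply: slid_loop_reduced => //.
rewrite -(gq_orig Q) -(gq_term Q) eYE oe te (quotient_actV Q) -/w -/z qwz => h.
apply: stab_z_large => g hg.
have : stabV (q z) (t * g * t^-1).
  apply: h; apply/stabV_act; rewrite conj_cancel.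
  by apply: (quotient_stabV Q).
rewrite (collapse_stabV cb Q nwz) => /sA.
by rewrite /monodromy conj_cancel.
Qed.

Let p1 := slid_orig eY [set y | S1 (i y)].
Let p2 := @slid_orig G Y1 fY [set y | S2 (i y)].
Let p1E y : p1 y = q (o1 (i y)). Proof. exact: esym (gq_orig Q1 y). Qed.
Let p2E y : p2 y = q (o2 (i y)). Proof. exact: esym (gq_orig Q2 y). Qed.
Let spreadY y : @spread G Y1 [set y | S2 (i y)] y -> @spread G X1 S2 (i y).
Proof.
case=> g [s [Ss E]]; exists g, (i s); split=> //.
by rewrite E; exact: (quotient_actE Q).
Qed.

(* A collapsible edge either slid to [x], so that the group of [x] would lie in that of
   [w], or was a loop one of whose ends slid away; but by [hub] the other end slides too. *)
Let rY2 : reduced Y2.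
Proof.
move=> y /collapsibleP[].
change (@stabE G Y y = stabV (p2 y) -> ~ orbV (p2 y) (p2 (rev y)) -> False).
have [[g [s [Ss Es]]]|ns] := pselect (@spread G Y1 [set y | S2 (i y)] y).
  have -> : p2 y = actV g (q x).
    rewrite /p2 Es (slid_orig_in slY2) //; congr actV.
    change (p1 (rev fY) = q x); rewrite p1E (gq_rev Q) fYE (o1E S1f) ?orig_rev //.
    by apply: geom_rev; exact: geom_refl.
  move=> hs _; apply: stab_x_large => k hk.
  have : @stabE G Y y (g * k * g^-1).
    rewrite hs; apply/stabV_act; rewrite conj_cancel.
    by apply: (quotient_stabV Q).
  rewrite Es => /stabE_act; rewrite conj_cancel => ks.
  have : @stabE G Y fY k by apply: (slidable_stab slY2 Ss); rewrite /= ks.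
  by rewrite -(quotient_stabE Q) fYE sf.
have E2 : p2 y = p1 y by rewrite /p2 slid_orig_out.
rewrite E2 => hs hn.
have l1 : orbV (p1 y) (p1 (rev y)).
  by apply: contrapT => n; apply: (rY1 (e := y)); apply/collapsibleP.
have [|nr] := pselect (@spread G Y1 [set y | S2 (i y)] (rev y)); last first.
  by apply: hn; rewrite /p2 slid_orig_out.
move=> sr; have := sr => -[g [s [Ss Es]]].
have : orbV (p1 (rev y)) (q w).
  rewrite Es p1E (quotient_actE Q); exists g^-1.
  rewrite -(quotient_actV Q) /o1 (slid_orig_act sl1) actVK -/o1.
  by case: Ss => ->.
move/(orbV_trans l1)/orbV_sym; rewrite p1E => /(collapse_orbV cb Q) h.
have {}h : orbV w (o1 (i y)) \/ orbV z (o1 (i y)).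
  by case: h => [|[_]|[_]|[_]]; [left|right|left|left].
have excl (d : edge X) : (forall s, S2 s -> ~ geom_orbit d s) -> ~ geom_orbit d (i y).
  move=> hd /geom_rev; rewrite -(gq_rev Q) => hr.
  exact: (@geom_not_spread G X1 _ d _ hd hr (spreadY sr)).
case: (hub h); [|exact: excl|exact: excl|exact: excl].
case=> k [s' [Ss' Es']]; apply: ns; exists k, (actE k^-1 y); split; last by rewrite [RHS](actEKV).
by rewrite /= (quotient_actE Q) Es' actEK.
Qed.

(* The three edges are not affected by the slides. *)
Let collapsible_X2 d : (forall s, S1 s -> ~ geom_orbit d s) -> (forall s, S2 s -> ~ geom_orbit d s) ->
  collapsible d -> @collapsible G X2 d.
Proof.
move=> h1 h2 cd; apply: (@collapsible_slid G X1 f S2 sl2 d h2).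
exact: collapsible_slid.
Qed.

Variables (Z : gtree G) (qf : vertex X -> vertex Z) (jf : edge Z -> edge X).
Hypothesis Cf : is_collapse f qf jf.

Let Qf : quotient (geom_orbit f) qf jf.
Proof. exact: ((collapse_quotient _ _ _).1 Cf).2. Qed.
Let eZ_ex : {eZ | jf eZ = e}.
Proof. by apply: cid; apply/(gq_range Qf) => /geom_sym. Qed.
Let eZ := sval eZ_ex.
Let eZE : jf eZ = e. Proof. exact: svalP eZ_ex. Qed.
Let nzx : ~ orbV z x. Proof. exact: nx. Qed.
Let nzw : ~ orbV z w. Proof. by move/orbV_sym. Qed.

Let ceZ : collapsible eZ.
Proof.
apply/collapsibleP.
rewrite -(quotient_stabE Qf) -(gq_orig Qf) -(gq_term Qf) eZE oe te se.
rewrite (collapse_stabV cf Qf) ?ofb //; split=> //.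
rewrite -/w -/z => h.
have {h} : orbV (qf z) (qf w).
  by apply: orbV_trans h _; rewrite (quotient_actV Qf); apply: orbV_sym; exact: orbV_act.
move/(collapse_orbV cf Qf); rewrite ofb -/w -/x => -[//|[/nwz]|[h _]|[/nwz]] //.
by apply: nzx; exact: orbV_sym.
Qed.

(** [T] is the collapse of [X] along [f] and [e], and by [slid_quotient_absorb] also
    that of the slid tree [X2]. The A-inverse move passes from [Y2 = X2/b] through the
    expansion [X2] to [T]. *)
Lemma A_move_reduction : exists T, [/\ collapse_move Z T, reduced T & A_inv_move Y2 T].
Proof.
have [T [r [j CT]]] := collapse_exists ceZ.
have [_ QT] := (collapse_quotient _ _ _).1 CT.
have QXT := quotient_comp Qf QT; rewrite (quotient_geom_image Qf) eZE in QXT.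
pose qT := r \o qf.
have qTact g v : qT (actV g v) = actV g (qT v) by exact: (quotient_actV QXT).
have wz : orbV (qT w) (qT z).
  have -> : qT z = qT (term e).
    by rewrite /z -oe; exact: (gq_contract QXT (or_intror (geom_refl e))).
  by rewrite te; apply: (quotient_orbV QXT); exact: orbV_act.
have zw := orbV_sym wz.
have wx : qT w = qT x.
  by rewrite /w -ofb; exact: (gq_contract QXT (or_introl (geom_refl f))).
exists T; split; first by exists eZ, r, j.
  (* A collapsible edge of [T] is compared with [b]: it cannot survive in the reduced
     tree [Y], it is no loop in [T], and so it starts at [w], where it is too small. *)
  move=> c' cc'; have [sc nlc] := (collapsibleP c').1 cc'.
  have cc := collapsible_lift QXT cc'; set c := (jf \o j) c' in cc.
  have nl : ~ orbV (qT (orig c)) (qT (term c)).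
    by rewrite [qT (orig c)](gq_orig QXT) [qT (term c)](gq_term QXT).
  have [bc|nbc] := pselect (geom_orbit b c).
    apply: nl; case/geomP: bc => g [] ->; rewrite orig_act term_act ?orig_rev ?term_rev;
      rewrite !qTact;
      apply: orbV_trans (orbV_sym (orbV_act _ g)) (orbV_trans _ (orbV_act _ g)) => //.
  case: (collapse_trichotomy cb Q cc nbc) => [[c1 _ /rY] //|[g Eg]|[h1 h2]].
    apply: stab_x_large => k hk.
    have : stabV (orig c') (g * k * g^-1).
      have -> : orig c' = actV g (qT w) by rewrite -qTact -Eg; exact: esym (gq_orig QXT c').
      apply/stabV_act.
      rewrite conj_cancel [_ w]wx.
      by apply: (quotient_stabV QXT).
    rewrite -sc -(quotient_stabE QXT) -/c => /stabE_orig; rewrite Eg => /stabV_act.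
    by rewrite conj_cancel.
  apply: nl; apply: orbV_trans (orbV_sym (quotient_orbV QXT h1)) _.
  by apply: orbV_trans zw _; exact: (quotient_orbV QXT h2).
have QX1T : @quotient G X1 T (geom_orbit f `|` geom_orbit e) qT (jf \o j).
  by apply: (slid_quotient_absorb sl1 QXT); [right; exact: geom_refl|move=> s [_ ? _ ?] []].
have QX2T : @quotient G X2 T (geom_orbit f `|` geom_orbit e) qT (jf \o j).
  by apply: (slid_quotient_absorb sl2 QX1T); [left; exact: geom_refl|move=> s [_ ? _ ?] []].
have c2e := collapsible_X2 S1e S2e ce.
have c2b := collapsible_X2 S1b S2b cb.
have oeY : @orig Y2 eY = q z.
  by change (p2 eY = q z); rewrite p2E eYE (o2e (geom_refl e)) oe.
have ofY : @orig Y2 fY = q z.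
  by change (p2 fY = q z); rewrite p2E fYE (o2f (geom_refl f)) ofb -qwz.
have tfY : @term Y2 fY = q x.
  change (p2 (rev fY) = q x); rewrite p2E (gq_rev Q) fYE o2f ?orig_rev //.
  by apply: geom_rev; exact: geom_refl.
have sfY : @stabE G Y2 fY = stabV w by rewrite -(quotient_stabE Q2) fYE.
(* In [Y2] only the loop and [f] remain at the image of [z]. *)
have incident y : @orig Y2 y = q z -> @geom_orbit G Y2 eY y \/ @orbitE G Y2 fY y.
  change (p2 y = q z -> @geom_orbit G Y eY y \/ @orbitE G Y fY y).
  rewrite p2E => Ey.
  have nby : ~ geom_orbit b (i y) by exact: (gq_notin Q).
  have hj := collapse_eq cb Q nwz Ey.
  have nxj g : o2 (i y) <> actV g x.
    case: hj => [->|[h [-> _]]] E; first by apply: nzx; exists g^-1; rewrite E actVK.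
    by apply: nwx; exists (g^-1 * h); rewrite actVM E actVK.
  have : geom_orbit e (i y) \/ geom_orbit f (i y).
    have ns : ~ @spread G X1 S2 (i y).
      case=> g [s [Ss Es]]; apply: (nxj g); rewrite /o2 Es (slid_orig_in sl2) //; congr actV.
      change (o1 (rev f) = x); rewrite (o1E S1f) ?orig_rev //.
      by apply: geom_rev; exact: geom_refl.
    have E12 : o2 (i y) = o1 (i y) by exact: slid_orig_out.
    rewrite E12 in hj.
    have : orbV w (o1 (i y)) \/ orbV z (o1 (i y)).
      case: hj => [->|[g [-> _]]]; first by right; exact: orbV_refl.
      by left; exact: orbV_act.
    by case/hub => // ?; [left|right].
  case=> [hy|fy].
    by left; rewrite -(quotient_geom Q) eYE.
  have [g [] Eg] := (geomP _ _).1 fy.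
    right; apply/orbitEP; exists g; apply: (gq_inj Q).
    by rewrite Eg (quotient_actE Q) fYE.
  case: (nxj g); rewrite o2f // Eg orig_act orig_rev //.
have [Y' [qe [je CE]]] := collapse_exists c2e.
have QE := ((collapse_quotient _ _ _).1 CE).2.
have [|q' [i' [QF _ _]]] := quotient_factor QE QX2T; first by move=> y; right.
have [f' Ef'] : exists f' : edge Y', je f' = f by apply/(gq_range QE); exact: nef.
have FE : [set y | (geom_orbit f `|` geom_orbit e) (je y)] = geom_orbit f'.
  apply/seteqP; split=> y /=.
    case; first by rewrite -Ef' => /(quotient_geom QE).
    by move=> h; case: (gq_notin QE h).
  by move/(quotient_geom QE); rewrite Ef'; left.
rewrite FE in QF.
have oe2 : @orig X2 e = z by change (o2 e = z); rewrite o2e // ; exact: geom_refl.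
have te2 : @term X2 e = actV t w.
  change (o2 (rev e) = actV t w); rewrite o2e ?orig_rev //.
  by apply: geom_rev; exact: geom_refl.
have of2 : @orig X2 f = w by change (o2 f = w); rewrite o2f //; exact: geom_refl.
have tf2 : @term X2 f = x.
  change (o2 (rev f) = x); rewrite o2f ?orig_rev //.
  by apply: geom_rev; exact: geom_refl.
have cf' : collapsible f'.
  apply/collapsibleP; rewrite -(quotient_stabE QE) -(gq_orig QE) -(gq_term QE) Ef' of2 tf2.
  have nzw2 : ~ @orbV G X2 (@orig X2 e) w by rewrite oe2.
  rewrite (collapse_stabV c2e QE nzw2); split; first exact: sf.
  move/(collapse_orbV c2e QE); rewrite oe2 te2 => -[//|[/nzw]|[_ /nzx]|[/nzw]] //.
have sqz : @stabV G Y2 (q z) = stabV z by exact: (collapse_stabV cb Q nwz).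
have sqx : @stabV G Y2 (q x) = stabV x by exact: (collapse_stabV cb Q nwx).
have seY : @stabE G Y2 eY = stabV z by rewrite -(quotient_stabE Q2) eYE; exact: se.
have teY : @term Y2 eY = actV t (q z).
  change (p2 (rev eY) = actV t (q z)); rewrite p2E (gq_rev Q) eYE o2e.
    by rewrite orig_rev te (quotient_actV Q) -/w qwz.
  by apply: geom_rev; exact: geom_refl.
exists eY, fY, t; rewrite /ascending_loop oeY ofY tfY teY seY sfY sqz sqx; split.
  split=> //.
  by move=> h; apply: loopless; move/orbitVP: h; rewrite qwz.
split; first split.
- by move=> _ [g hg <-]; exact: sA.
- split=> //; by rewrite -sb; exact: stabE_term.
- by split=> //; rewrite -sf; exact: stabE_term.
exists X2, b, q, i; split; last first.
  exists Y', qe, je; split; first by rewrite eYE.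
  exists f', q', i'; rewrite fYE; split=> //; exact/collapse_quotient.
have ob2 : @orig X2 b = w by change (o2 b = w); rewrite o2b //; exact: geom_refl.
have tb2 : @term X2 b = z.
  change (o2 (rev b) = z); rewrite o2b ?orig_rev //.
  by apply: geom_rev; exact: geom_refl.
split.
- exact/collapse_quotient.
- by rewrite ob2.
- by rewrite ob2.
- exact: sb.
- move=> y [|] ->; rewrite ob2.
    change (o2 (i (actE t^-1 (rev eY))) = w).
    rewrite (quotient_actE Q) (gq_rev Q) eYE o2e.
      by rewrite orig_act orig_rev te actVK.
    by apply: geom_act; apply: geom_rev; exact: geom_refl.
  by rewrite fYE.
move=> y Ey nM; rewrite tb2.
have : q (o2 (i y)) = q z by rewrite -p2E.
change (@orig X2 (i y)) with (o2 (i y)).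
move/(collapse_eq cb Q nwz) => [//|[g [E _]]]; case: nM.
case: (incident y Ey) => [ey|]; last by exists fY => //; right.
(* [y] starts at a translate of [w], so it is a translate of the reverse of [e]. *)
exists (actE t^-1 (rev eY)); first by left.
have ejy : geom_orbit e (i y) by rewrite -eYE (quotient_geom Q).
rewrite (o2e ejy) in E.
case/geomP: ey => h [] Eh.
  have Eg : actV h z = actV g w.
    by rewrite /w -E Eh (quotient_actE Q) eYE orig_act oe.
  by case: nzw; exists (g^-1 * h); rewrite actVM Eg actVK.
by apply/orbitEP; exists (h * t); rewrite [RHS]actEM actEKV.
Qed.

Lemma A_move_equi : equi_reducible Y Z.
Proof.
have [T [ZT rT mT]] := A_move_reduction.
have ZT' : reduces Z T by apply: Reduces_step ZT _; apply: Reduces_iso; exact: iso_refl.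
have ZZ : equi_reducible Z Z by apply: (@collapses_to_equi f); exists qf, jf.
apply: (equi_reduces rT ZZ ZT' rY).
apply: (@related_trans _ _ Y1).
  by apply: rt_step; split=> //; apply: Move_slide; exact: slide_slid.
apply: (@related_trans _ _ Y2).
  by apply: rt_step; split=> //; apply: Move_slide; exact: slide_slid.
by apply: rt_step; split=> //; exact: Move_A_inv.
Qed.

End AMove.

(** ** The induction move

    Now [a] goes from [w] to [x] and [b] from [x] back to a translate of [w]. In [Y = X/a]
    the edge [b] is an ascending loop with the group of [x], in [Z = X/b] the edge [a]
    is one with the smaller group of [w]. *)
Section InductionMove.
Variables (a b : edge X) (t : G) (Y Z : gtree G).
Variables (q1 : vertex X -> vertex Y) (i1 : edge Y -> edge X).
Variables (q2 : vertex X -> vertex Z) (i2 : edge Z -> edge X).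
Hypotheses (C1 : is_collapse a q1 i1) (C2 : is_collapse b q2 i2).
Hypotheses (ob : orig b = term a) (tb : term b = actV t (orig a)).
Hypotheses (nab : ~ geom_orbit a b) (nra : ~ collapsible (rev a)).
Hypotheses (rY : reduced Y) (rZ : reduced Z).

Let w := orig a.
Let x := term a.
Let ca : collapsible a. Proof. exact: collapse_collapsible C1. Qed.
Let cb : collapsible b. Proof. exact: collapse_collapsible C2. Qed.
Let Q1 : quotient (geom_orbit a) q1 i1.
Proof. exact: ((collapse_quotient _ _ _).1 C1).2. Qed.
Let Q2 : quotient (geom_orbit b) q2 i2.
Proof. exact: ((collapse_quotient _ _ _).1 C2).2. Qed.
Let sa : stabE a = stabV w. Proof. exact: ((collapsibleP a).1 ca).1. Qed.
Let sb : stabE b = stabV x. Proof. by rewrite /x -ob; exact: ((collapsibleP b).1 cb).1. Qed.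
Let nwx : ~ orbV w x. Proof. exact: ((collapsibleP a).1 ca).2. Qed.
Let nxw : ~ orbV x w. Proof. by move/orbV_sym. Qed.
Let qwx : q1 w = q1 x. Proof. exact: collapse_contract Q1. Qed.

(* An induction move from [Y] leaves the edges at [w] attached at [x]. They therefore
   slide over [a] first: this is invisible in [Y], and a slide over the loop in [Z]. *)
Let S : set (edge X) := [set s | [/\ orig s = w, ~ geom_orbit a s & ~ geom_orbit b s]].
Let Sa s : S s -> ~ geom_orbit a s. Proof. by case. Qed.
Let Sb s : S s -> ~ geom_orbit b s. Proof. by case. Qed.
Let sl : slidable a S. Proof. by apply: slidable_small => // s []. Qed.
Let X' := slid sl.
Let o' := slid_orig a S.
Let o'E d y : (forall s, S s -> ~ geom_orbit d s) -> geom_orbit d y -> o' y = orig y.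
Proof. by move=> h dy; apply: slid_orig_out; exact: geom_not_spread h dy. Qed.

Let aZ_ex : {aZ | i2 aZ = a}.
Proof. by apply: cid; apply/(gq_range Q2) => /geom_sym. Qed.
Let aZ := sval aZ_ex.
Let aZE : i2 aZ = a. Proof. exact: svalP aZ_ex. Qed.
Let bY_ex : {bY | i1 bY = b}.
Proof. by apply: cid; apply/(gq_range Q1). Qed.
Let bY := sval bY_ex.
Let bYE : i1 bY = b. Proof. exact: svalP bY_ex. Qed.

Let slZ : slidable aZ [set y | S (i2 y)].
Proof. exact: slidable_quotient Q2 aZE sl. Qed.
Let Z' := slid slZ.
Let QY : @quotient G X' Y (geom_orbit a) q1 i1.
Proof. by apply: slid_quotient_absorb => //; exact: geom_refl. Qed.
Let QZ : @quotient G X' Z' (geom_orbit b) q2 i2.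
Proof. exact: slid_quotient Q2 aZE Sb. Qed.

(* Otherwise the groups of [a] and [x] would agree and the reverse of [a] be collapsible. *)
Let rZ' : reduced Z'.
Proof.
have E : q2 x = actV t (q2 w).
  by rewrite /x -ob (collapse_contract Q2) tb (quotient_actV Q2).
apply: slid_loop_reduced => //; rewrite -(gq_orig Q2) -(gq_term Q2) aZE -/w -/x.
  by rewrite E; exact: orbV_act.
have nbw : ~ orbV (orig b) w by rewrite ob.
rewrite (collapse_stabV cb Q2 nbw) => h; apply: nra; apply/collapsibleP.
rewrite orig_rev term_rev stabE_rev; split=> //; apply/seteqP; split.
  exact: stabE_term.
by rewrite sa => g hg; apply: h; apply: (quotient_stabV Q2).
Qed.

Let inductionYZ' : induction_step Y Z'.
Proof.
have obY : orig bY = q1 x by rewrite -(gq_orig Q1) bYE ob.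
have sx : stabV (q1 x) = stabV x by exact: (collapse_stabV ca Q1 nwx).
have oa : @orig X' a = w by change (o' a = w); rewrite (o'E Sa) //; exact: geom_refl.
have ta : @term X' a = x.
  change (o' (rev a) = x); rewrite (o'E Sa) ?orig_rev //.
  by apply: geom_rev; exact: geom_refl.
exists bY, t, (stabV w); split.
  split.
  - split; first by rewrite obY -(gq_term Q1) bYE tb (quotient_actV Q1) -/w qwx.
    by rewrite obY sx -(quotient_stabE Q1) bYE.
  - exact: subgroup_stabV.
  - rewrite obY sx => _ [g hg <-]; move: hg; rewrite -sb => /stabE_term.
    by rewrite tb => /stabV_act.
  - by rewrite obY sx -sa; exact: stabE_term.
exists X', a, q1, i1; split; last first.
  rewrite bYE; exists q2, i2; apply/collapse_quotient; split=> //.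
  exact: collapsible_slid.
split.
- by apply/collapse_quotient; split=> //; exact: collapsible_slid.
- by rewrite oa obY.
- by rewrite oa.
- exact: sa.
- move=> y ->; rewrite oa; change (o' (i1 (actE t^-1 (rev bY))) = w).
  rewrite (quotient_actE Q1) (gq_rev Q1) bYE (o'E Sb).
    by rewrite orig_act orig_rev tb actVK.
  by apply: geom_act; apply: geom_rev; exact: geom_refl.
move=> y oy nM; rewrite ta.
change (@orig X' (i1 y)) with (o' (i1 y)).
have : q1 (o' (i1 y)) = q1 x by rewrite -obY -oy; exact: (gq_orig QY).
move/(collapse_eq ca Q1 nwx) => [//|[g [E _]]]; case: nM.
have ns : ~ spread S (i1 y).
  case=> k [s [Ss Es]]; apply: nwx; exists (k^-1 * g).
  by rewrite actVM /w -E Es /o' (slid_orig_in sl) // actVK.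
have E2 : orig (i1 y) = actV g w by rewrite -E /o' slid_orig_out.
have [by_|nb] := pselect (geom_orbit b (i1 y)); last first.
  case: (ns); exists g, (actE g^-1 (i1 y)); split; last by rewrite actEKV.
  split; try by move/geom_actE.
    by rewrite orig_act E2 actVK.
  by move/geom_actE; exact: (gq_notin Q1).
exists (actE t^-1 (rev bY)); first by [].
have : geom_orbit bY y by rewrite -(quotient_geom Q1) bYE.
case/geomP=> h [] Eh.
  case: nxw; exists (g^-1 * h); rewrite actVM.
  have -> : actV h x = actV g w.
    by rewrite -E2 Eh (quotient_actE Q1) bYE orig_act ob.
  by rewrite actVK.
by apply/orbitEP; exists (h * t); rewrite actEM actEKV.
Qed.

Lemma induction_move_equi : equi_reducible Y Z.
Proof.
apply: equi_reduced => //; apply: (@related_trans _ _ Z').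
  by apply: rt_step; split=> //; apply: Move_induction; left.
apply: rt_step; split=> //; apply: Move_slide; apply: slide_sym.
exact: slide_slid.
Qed.

End InductionMove.

(** ** Pairs of collapsible edges *)

(** If [X/b] is reduced this is [A_move_equi]. Otherwise an edge [c] that remains
    collapsible in [X/b] is compared with [f]: if they start together, [b] is small at
    both ends and its reverse links [b] to [f]; if they are opposite, the chain is
    [f ~ e ~ c ~ b], as [e] is independent of both [f] and [c]. *)
Lemma similar_A f b e : collapsible f -> collapsible b -> collapsible e ->
  orig f = orig b -> orbV (term b) (orig e) -> orbV (orig b) (term e) ->
  ~ orbV (term b) (term f) -> similar b f.
Proof.
move=> cf cb ce ofb obe ote nzx.
have [_ nwz] := (collapsibleP b).1 cb; have [_ nwx] := (collapsibleP f).1 cf.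
have ef : similar e f.
  case: (similar_trichotomy ce cf) => [//|h|[_ h]].
    by case: nwz; rewrite -ofb; apply: orbV_sym; exact: orbV_trans obe h.
  by case: nzx; exact: orbV_trans obe h.
have [be|nbe] := pselect (geom_orbit b e).
  exact: similar_trans ce (similar_geom be) ef.
move=> Y Z [q [i C]] [qf [jf Cf]].
have [rY|] := pselect (reduced Y).
  case: obe => g Eg; case: ote => h Eh.
  apply: (@A_move_equi f b (actE g^-1 e) (g^-1 * h) Y q i _ _ C _ _ _ _ _ _ Z qf jf Cf) => //.
  - exact: collapsible_act.
  - by rewrite orig_act Eg actVK.
  - by rewrite term_act Eh actVM.
  - by move/geom_actE.
move=> /existsNP[c' /contrapT cc'].
suff : similar b f by apply; [exists q, i|exists qf, jf].
have [_ Q] := (collapse_quotient _ _ _).1 C.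
have cc := collapsible_lift Q cc'.
have bc := similar_collapse C cc'.
apply: (similar_trans cc bc); apply: similar_sym.
case: (similar_trichotomy cf cc) => [//|h|[h1 h2]].
  rewrite ofb in h; have crb := collapsible_rev cb Q cc' h.
  have rbb : similar (rev b) b by apply: similar_geom; apply/geom_sym/geom_revE/geom_refl.
  apply: (similar_trans cb _ bc); apply: (similar_trans crb _ rbb); apply: similar_sym.
  case: (similar_trichotomy crb cf) => [//|h'|[_ h']].
    by case: nwz; rewrite -ofb; apply: orbV_sym; rewrite orig_rev in h'.
  by case: nzx; rewrite orig_rev in h'.
apply: (similar_trans ce (similar_sym ef)).
case: (similar_trichotomy ce cc) => [//|h'|[h' _]].
  by case: nzx; apply: orbV_trans (orbV_trans obe h') (orbV_sym h1).
case: nwx; rewrite ofb.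
by apply: orbV_trans (orbV_trans ote h') (orbV_sym h1).
Qed.

(** Here [c'] links [a] to [b] unless it, too, starts at the common origin or is
    opposite to [b]. In either case there is a configuration for [similar_A], with
    the reverse of [a], respectively [c'], as the edge opposite to [b]. *)
Lemma similar_slide_unreduced a b Y (q : vertex X -> vertex Y) i (c' : edge Y) :
  collapsible b -> is_collapse a q i -> collapsible c' -> orig a = orig b ->
  similar a b.
Proof.
move=> cb C cc' oab; have [ca Q] := (collapse_quotient _ _ _).1 C.
have cc := collapsible_lift Q cc'; have ac := similar_collapse C cc'.
have [_ nlc] := (collapsibleP c').1 cc'; have [_ nlb] := (collapsibleP b).1 cb.
rewrite -(gq_orig Q) -(gq_term Q) in nlc.
set c := i c' in cc ac nlc.
case: (similar_trichotomy cb cc) => [bc|h|[h1 h2]].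
- exact: similar_trans cc ac (similar_sym bc).
- have hac : orbV (orig a) (orig c) by rewrite oab.
  have cra := collapsible_rev ca Q cc' hac.
  have raa : similar a (rev a) by apply: similar_geom; apply/geom_revE/geom_refl.
  case: (similar_trichotomy cra cb) => [rab|h'|[_]].
  + exact: similar_trans cra raa rab.
  + have [_ nla] := (collapsibleP a).1 ca; case: nla; rewrite oab.
    by apply: orbV_sym; rewrite orig_rev in h'.
  rewrite orig_rev => h'.
  case: h => g Eg.
  have cgc : similar c (actE g^-1 c) by apply: similar_geom; apply: geom_act; exact: geom_refl.
  apply: (similar_trans cc ac (similar_trans _ cgc (similar_sym _))).
    exact: collapsible_act.
  apply: (@similar_A _ b (rev a)) => //.
  + exact: collapsible_act.
  + by rewrite orig_act Eg actVK.
  + by rewrite orig_rev; exact: orbV_sym.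
  + by rewrite term_rev oab; exact: orbV_refl.
  rewrite term_act => hx; apply: nlc.
  have hx' : orbV (term a) (term c).
    by apply: orbV_trans h' (orbV_trans hx (orbV_sym (orbV_act _ _))).
  apply: orbV_trans (orbV_sym (quotient_orbV Q hac)) _.
  by rewrite (collapse_contract Q); exact: (quotient_orbV Q hx').
have hl : ~ orbV (term b) (term a).
  move=> hx; apply: nlc.
  apply: orbV_trans (orbV_sym (quotient_orbV Q (orbV_trans (orbV_sym hx) h1))) _.
  by rewrite -(collapse_contract Q) oab; exact: (quotient_orbV Q h2).
apply: similar_sym; apply: (@similar_A a b c) => //.
Qed.

Lemma similar_slide a b : collapsible a -> collapsible b -> orig a = orig b ->
  similar a b.
Proof.
move=> ca cb oab; have [ab|nab] := pselect (geom_orbit a b).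
  exact: similar_geom.
move=> Y Z hY hZ; have := (hY, hZ) => -[[q1 [i1 C1]] [q2 [i2 C2]]].
have [rY|] := pselect (reduced Y); last first.
  move=> /existsNP[c' /contrapT cc'].
  exact: (similar_slide_unreduced cb C1 cc' oab).
have [rZ|] := pselect (reduced Z); last first.
  move=> /existsNP[c' /contrapT cc'].
  exact: (similar_sym (similar_slide_unreduced ca C2 cc' (esym oab))).
apply: equi_reduced => //; apply: rt_step; split=> //; apply: Move_slide.
exact: slide_of_two C1 C2 oab nab.
Qed.

Lemma similar_slide_orbit a b : collapsible a -> collapsible b ->
  orbV (orig a) (orig b) -> similar a b.
Proof.
move=> ca cb [g E].
have cgb : collapsible (actE g^-1 b) by exact: collapsible_act.
apply: (similar_trans cgb).
  by apply: similar_slide => //; rewrite orig_act E actVK.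
by apply: similar_geom; apply/geom_sym/geom_act/geom_refl.
Qed.

(** An edge opposite to [b] would be parallel to [a], hence a loop in [X/a]. *)
Lemma similar_opposite_unreduced a b Y (q : vertex X -> vertex Y) i (c' : edge Y) :
  collapsible b -> is_collapse a q i -> collapsible c' ->
  orbV (term a) (orig b) -> orbV (orig a) (term b) -> similar a b.
Proof.
move=> cb C cc' h1 h2; have [ca Q] := (collapse_quotient _ _ _).1 C.
have cc := collapsible_lift Q cc'; have ac := similar_collapse C cc'.
apply: (similar_trans cc ac (similar_sym _)).
case: (similar_trichotomy cb cc) => [//|h|[h3 h4]].
  exact: similar_slide_orbit.
have [_ []] := (collapsibleP c').1 cc'; rewrite -(gq_orig Q) -(gq_term Q).
apply: orbV_trans (orbV_sym (quotient_orbV Q (orbV_trans h2 h3))) _.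
by rewrite (collapse_contract Q); exact: (quotient_orbV Q (orbV_trans h1 h4)).
Qed.

Lemma similar_opposite a b : collapsible a -> collapsible b ->
  orbV (term a) (orig b) -> orbV (orig a) (term b) -> similar a b.
Proof.
move=> ca cb h1 h2; have [ab|nab] := pselect (geom_orbit a b).
  exact: similar_geom.
have [cra|nra] := pselect (collapsible (rev a)).
  apply: (similar_trans cra); first by apply/similar_geom/geom_revE/geom_refl.
  by apply: similar_slide_orbit => //; rewrite orig_rev.
move=> Y Z hY hZ; have := (hY, hZ) => -[[q1 [i1 C1]] [q2 [i2 C2]]].
have [rY|] := pselect (reduced Y); last first.
  move=> /existsNP[c' /contrapT cc'].
  exact: (similar_opposite_unreduced cb C1 cc').
have [rZ|] := pselect (reduced Z); last first.
  move=> /existsNP[c' /contrapT cc'].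
  apply: (similar_sym (similar_opposite_unreduced ca C2 cc' _ _)) => //; exact: orbV_sym.
case: h1 => g Eg; case: h2 => h Eh.
have gbb : geom_orbit (actE g^-1 b) b by apply/geom_sym/geom_act/geom_refl.
have gb : geom_orbit b (actE g^-1 b) by exact: geom_sym.
have C2' : is_collapse (actE g^-1 b) q2 i2.
  apply/collapse_quotient; split; first exact: collapsible_act.
  by rewrite (geom_eq gb); exact: ((collapse_quotient _ _ _).1 C2).2.
apply: (@induction_move_equi a (actE g^-1 b) (g^-1 * h) Y Z q1 i1 q2 i2 C1 C2') => //.
- by rewrite orig_act Eg actVK.
- by rewrite term_act Eh actVM.
- by move/geom_actE.
Qed.

Lemma similar_all a b : collapsible a -> collapsible b -> similar a b.
Proof.
move=> ca cb; case: (similar_trichotomy ca cb) => [//|h|[h1 h2]].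
  exact: similar_slide_orbit.
exact: similar_opposite.
Qed.

(** The induction step. *)
Lemma equi_self : equi_reducible X X.
Proof.
move=> R R' hR rR hR' rR'; have [rX|nrX] := pselect (reduced X).
  by apply: (equi_reduced rX rX) => //; exact: related_refl.
case: hR => [I|Y [a [q [i C]]] hR]; first by case: nrX; apply: reduced_iso rR; exact: iso_sym.
case: hR' => [I|Z [b [q' [i' C']]] hR']; first by case: nrX; apply: reduced_iso rR'; exact: iso_sym.
apply: (similar_all (collapse_collapsible C) (collapse_collapsible C') (Y := Y) (Z := Z)) => //.
  by exists q, i.
by exists q', i'.
Qed.

End Compare.

Lemma covered_equi (G : groupType) (X : gtree G) n :
  covered (@small G X) n -> equi_reducible X X.
Proof.
elim: n X => [|n IH] X hX; apply: equi_self => Y XY;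
  have [m Em hm] := small_collapse XY hX => //.
case: Em hm => <- hm; split; last by exists n.
exact: IH.
Qed.

Theorem theorem1p1 (G : groupType) (D : gtree G -> Prop)
    (hD : deformation_space D) (T T' : gtree G)
    (hT : D T) (hT' : D T') (rT : reduced T) (rT' : reduced T') :
  related_by_moves T T'.
Proof.
case: hD => T0 hD.
have step X Y : [\/ collapse_move X Y, collapse_move Y X | gtree_iso X Y] ->
    [\/ collapse_move Y X, collapse_move X Y | gtree_iso Y X].
  by case=> h; [apply: Or32|apply: Or31|apply: Or33; exact: iso_sym].
have def : elementary_deformation T T'.
  apply: rt_trans ((hD T').1 hT').
  elim: ((hD T).1 hT) => [X Y /step|X|X Y Z _ YX _ ZY].
  - exact: rt_step.
  - exact: rt_refl.
  - exact: rt_trans ZY YX.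
suff [H _] : (forall R, reduces T' R -> reduced R -> related_by_moves T R) /\
    exists n, covered (@small G T') n.
  by apply: H => //; apply: Reduces_iso; exact: iso_refl.
have := clos_rt_rtn1 _ _ _ _ def.
elim=> [|X Y XY _ [IH [n hn]]].
  split; last by exists 0 => v [e /rT].
  move=> R [I|Y /(reduced_no_step rT)//] rR; exact: related_iso.
case: XY => [XY|YX|I].
- have [m _ hm] := small_collapse XY hn; split; last by exists m.
  by move=> R hR; apply: IH; exact: Reduces_step XY hR.
- have [m hm] := small_expand YX hn; split; last by exists m.
  move=> R hR rR; have [R' hR' rR'] := covered_reducible hn.
  apply: related_trans (IH R' hR' rR') _.
  apply: (covered_equi hm) => //; exact: Reduces_step YX hR'.
- split; last by exists n; exact: small_iso I hn.
  by move=> R hR; apply: IH; exact: reduces_iso I hR.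
Qed.
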